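(* For each (complex-valued) function $f\in L_2(0,\pi)$ and any complex numbers $h,H$, the equation $$f(x)=\sum_{\nu=1}^\infty\Big(\psi_\nu(x)N^{*\nu}(x)+\int_0^x\Psi_\nu(x,t)N^{*\nu}(t)\,dt\Big),\quad 0<x<\pi,$$ where $$\psi_\nu(x)=\frac{(\pi-x)^\nu}{\nu!},$$ $$\Psi_\nu(x,t)=\frac{1}{\nu!}\Big(H(\pi-x)^\nu+h(\pi-t)^{\nu-1}\big(\pi-t+(x-t)(\nu+H(\pi-t))\big)\Big),$$ has a unique solution $N(x)$ with $(\pi-x)N(x)\in L_2(0,\pi)$.
   Context: $N$ is a complex-valued unknown function on $(0,\pi)$, and $N^{*\nu}$ denotes the iterated Volterra convolution: $N^{*1}=N$ and $N^{*(\nu+1)}(x)=\int_0^x N(x-t)N^{*\nu}(t)\,dt$ for $\nu\ge1$. The equation is understood to hold for almost every $x\in(0,\pi)$, and uniqueness is up to values on a set of measure zero. *)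

(* Defs.v *)
From HB Require Import structures.
From mathcomp Require Import all_boot all_order all_algebra.
From mathcomp Require Import complex.
From mathcomp Require Import all_classical all_reals all_analysis.

Set Implicit Arguments.
Unset Strict Implicit.
Unset Printing Implicit Defensive.

Import Order.TTheory GRing.Theory Num.Theory.
Import numFieldNormedType.Exports.

Local Open Scope classical_set_scope.
Local Open Scope ring_scope.
Local Open Scope complex_scope.

(* The library integrates real-valued functions only, so complex integrals and
   measurability are taken componentwise. *)
Definition Cintegral (R : realType) (D : set R) (F : R -> R[i]) : R[i] :=
  (\int[lebesgue_measure]_(t in D) complex.Re (F t))
    +i* (\int[lebesgue_measure]_(t in D) complex.Im (F t)).

Definition L2 (R : realType) (D : set R) (F : R -> R[i]) : Prop :=
  [/\ measurable_fun D (fun x => complex.Re (F x)),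
      measurable_fun D (fun x => complex.Im (F x)) &
      (\int[lebesgue_measure]_(x in D) ((ComplexField.Normc.normc (F x)) ^+ 2)%:E < +oo)%E].

(* The open interval keeps both arguments in ]0, x[, so that only the values of
   [F] and [G] there matter. *)
Definition Vconv (R : realType) (F G : R -> R[i]) (x : R) : R[i] :=
  Cintegral `]0, x[ (fun t => F (x - t) * G t).

(* [Vpow N 1] is [N] and [Vpow N nu.+1] is [Vconv N (Vpow N nu)] for [nu >= 1];
   [Vpow N 0] is a dummy value. *)
Definition Vpow (R : realType) (N : R -> R[i]) (nu : nat) : R -> R[i] :=
  iter nu.-1 (Vconv N) N.

Definition psi (R : realType) (nu : nat) (x : R) : R[i] :=
  ((pi - x) ^+ nu / nu`!%:R)%:C.

Definition Psi (R : realType) (h H : R[i]) (nu : nat) (x t : R) : R[i] :=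
  (nu`!%:R)^-1 *
  (H * ((pi - x) ^+ nu)%:C +
   h * ((pi - t) ^+ nu.-1)%:C *
     ((pi - t)%:C + (x - t)%:C * (nu%:R + H * (pi - t)%:C))).

Definition main_term (R : realType) (h H : R[i]) (N : R -> R[i])
    (x : R) (nu : nat) : R[i] :=
  psi nu x * Vpow N nu x +
  Cintegral `]0, x[ (fun t => Psi h H nu x t * Vpow N nu t).

(* The sum of the series is the pointwise limit of its partial sums; [R[i]^o] is
   [R[i]] with its norm topology. *)
Definition main_equation (R : realType) (h H : R[i]) (f N : R -> R[i]) : Prop :=
  {ae lebesgue_measure, forall x : R, `]0, pi[%classic x ->
     (fun n => \sum_(1 <= nu < n) main_term h H N x nu : R[i]^o) @ \oo
       --> (f x : R[i]^o)}.

(* Main.v *)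
Require Import Defs.
From mathcomp Require Import all_boot all_order all_algebra.
From mathcomp Require Import complex.
From mathcomp Require Import all_classical all_reals all_analysis.
From mathcomp Require Import measurable_realfun ring lra.

(* Put M(x) = (pi - x) N(x), so that the equation reads M = f - S(N), where S(N)
   collects all the other terms.  Since pi - x <= pi - (x - t) and
   pi - x <= pi - t for 0 < t < x < pi, the weight (pi - x)^nu is distributed
   over the factors of the convolution: (pi - x)^nu |N^{*nu}(x)| <= |M|^{*nu}(x).
   Together with |Psi_nu(x,t)| <= C (pi - t)^nu this removes the singularity at
   pi.  A further weight e^{-px} is multiplicative on convolutions, and for p
   large it makes M as small as desired in L1 and L2; since the convolution of
   two L2 functions is bounded, S(N) is bounded, and S is a contraction for the
   norm sup e^{-px} |M(x)|.  Picard iteration on M - f gives existence.  For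
   uniqueness, M - f = - S(N) is bounded for every solution, so that the
   difference of two solutions is bounded and the contraction applies to it. *)

Set Implicit Arguments.
Unset Strict Implicit.
Unset Printing Implicit Defensive.

Import Order.TTheory GRing.Theory Num.Theory.
Import numFieldNormedType.Exports.

Local Open Scope classical_set_scope.
Local Open Scope ring_scope.
Local Open Scope complex_scope.

(** Two different mechanisms make [S] contract. A term with at least two factors [N] has a Lipschitz
    constant containing the L1 size [l] of e^{-px} M. The integral term with nu = 1 is linear in
    [N], so no such factor appears; there the splitting e^{-px} = e^{-p(x-t)} e^{-pt} dominates the
    Volterra integral by a convolution with the exponential, and it is the L1 norm [e] of that
    exponential which is small. Since M is merely in L2, its L2 bound is spent once, on the
    convolution square; from then on all powers are bounded and each further factor [N] costs only
    [l]. The terms are thus geometric in [l], and the factorials absorb factors nu rather than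
    provide convergence. For such [N] the series converges at every point of (0, pi), so the
    equation becomes a pointwise identity, and null sets matter only for uniqueness. *)

Section theory.
Context {R : realType}.
Implicit Types (D : set R).
Local Notation mu := (@lebesgue_measure R).
Implicit Types (z w : R[i]) (c : R).

(* Preferred to the modulus because [Cintegral] is componentwise: bounding
   [norm1 (Cintegral D F)] by the integral of [norm1 \o F] needs no rotation. *)
Definition norm1 z : R := `|complex.Re z| + `|complex.Im z|.

Lemma norm1_ge0 z : 0 <= norm1 z.
Proof. by rewrite addr_ge0. Qed.

Lemma norm10 : norm1 0 = 0.
Proof. by rewrite /norm1 /= normr0 addr0. Qed.

Lemma norm1_eq0 z : norm1 z <= 0 -> z = 0.
Proof.
case: z => a b; rewrite /norm1 /= => h.
have a0 : a = 0.
  by apply/eqP; rewrite -normr_le0; have := normr_ge0 b; lra.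
have b0 : b = 0.
  by apply/eqP; rewrite -normr_le0; have := normr_ge0 a; lra.
by rewrite a0 b0.
Qed.

Lemma norm1N z : norm1 (- z) = norm1 z.
Proof. by case: z => a b; rewrite /norm1 /= !normrN. Qed.

Lemma norm1D z w : norm1 (z + w) <= norm1 z + norm1 w.
Proof.
by case: z w => [a b] [c d]; rewrite /norm1 /= addrACA lerD ?ler_normD.
Qed.

Lemma norm1B z w : norm1 (z - w) <= norm1 z + norm1 w.
Proof. by rewrite -(norm1N w) norm1D. Qed.

Lemma norm1C z w : norm1 (z - w) = norm1 (w - z).
Proof. by rewrite -norm1N opprB. Qed.

Lemma norm1M z w : norm1 (z * w) <= norm1 z * norm1 w.
Proof.
case: z w => [a b] [c d]; rewrite /norm1 /=.
have := ler_normB (a * c) (b * d); have := ler_normD (a * d) (b * c).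
rewrite !normrM; nra.
Qed.

Lemma norm1Zl c z : norm1 (c%:C * z) = `|c| * norm1 z.
Proof.
by case: z => a b; rewrite /norm1 /= !mul0r subr0 addr0 !normrM mulrDr.
Qed.

Lemma norm1_real c : norm1 c%:C = `|c|.
Proof. by rewrite /norm1 /= normr0 addr0. Qed.

Lemma norm1_sum (I : Type) (s : seq I) (F : I -> R[i]) :
  norm1 (\sum_(i <- s) F i) <= \sum_(i <- s) norm1 (F i).
Proof.
elim/big_ind2 : _ => //= [|z c w d zc wd]; first by rewrite norm10.
by rewrite (le_trans (norm1D _ _))// lerD.
Qed.

Lemma normc_le_norm1 z : ComplexField.Normc.normc z <= norm1 z.
Proof.
case: z => a b /=; rewrite -[leRHS]ger0_norm ?norm1_ge0// -sqrtr_sqr.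
rewrite ler_wsqrtr// /norm1 /= sqrrD !real_normK ?num_real//.
by rewrite lerD2r lerDl mulrn_wge0// mulr_ge0.
Qed.

Lemma norm1_sqr_le z : norm1 z ^+ 2 <= 2 * ComplexField.Normc.normc z ^+ 2.
Proof.
case: z => a b /=; rewrite sqr_sqrtr ?addr_ge0 ?sqr_ge0// /norm1 /=.
have := sqr_ge0 (`|a| - `|b|); rewrite sqrrB sqrrD !real_normK ?num_real//.
lra.
Qed.

Lemma normc_sqr_le z : ComplexField.Normc.normc z ^+ 2 <= norm1 z ^+ 2.
Proof.
rewrite lerXn2r ?nnegrE ?norm1_ge0 ?normc_le_norm1//.
by case: z => a b /=; exact: sqrtr_ge0.
Qed.



(** * Complex-valued integrals *)

Definition Cmeas d (T : measurableType d) (D : set T) (F : T -> R[i]) :=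
  measurable_fun D (fun x => complex.Re (F x)) /\
  measurable_fun D (fun x => complex.Im (F x)).

Lemma CmeasD d (T : measurableType d) (D : set T) (F G : T -> R[i]) :
  Cmeas D F -> Cmeas D G -> Cmeas D (fun x => F x + G x).
Proof.
move=> [mFr mFi] [mGr mGi]; split.
- rewrite [X in measurable_fun _ X](_ : _ =
    (fun x => complex.Re (F x) + complex.Re (G x))); last first.
    by apply/funext => x; case: (F x) => ? ?; case: (G x).
  exact: measurable_funD.
- rewrite [X in measurable_fun _ X](_ : _ =
    (fun x => complex.Im (F x) + complex.Im (G x))); last first.
    by apply/funext => x; case: (F x) => ? ?; case: (G x).
  exact: measurable_funD.
Qed.

Lemma CmeasN d (T : measurableType d) (D : set T) (F : T -> R[i]) :
  Cmeas D F -> Cmeas D (fun x => - F x).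
Proof.
move=> [mFr mFi]; split.
- rewrite [X in measurable_fun _ X](_ : _ = \- (fun x => complex.Re (F x)));
    last by apply/funext => x; rewrite /=; case: (F x).
  exact: measurableT_comp.
- rewrite [X in measurable_fun _ X](_ : _ = \- (fun x => complex.Im (F x)));
    last by apply/funext => x; rewrite /=; case: (F x).
  exact: measurableT_comp.
Qed.

Lemma CmeasB d (T : measurableType d) (D : set T) (F G : T -> R[i]) :
  Cmeas D F -> Cmeas D G -> Cmeas D (fun x => F x - G x).
Proof. by move=> mF mG; apply: CmeasD => //; exact: CmeasN. Qed.

Lemma CmeasM d (T : measurableType d) (D : set T) (F G : T -> R[i]) :
  Cmeas D F -> Cmeas D G -> Cmeas D (fun x => F x * G x).
Proof.
move=> [mFr mFi] [mGr mGi]; split.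
- rewrite [X in measurable_fun _ X](_ : _ =
    (fun x => complex.Re (F x) * complex.Re (G x)
            - complex.Im (F x) * complex.Im (G x))); last first.
    by apply/funext => x; case: (F x) => ? ?; case: (G x).
  by apply: measurable_funB; apply: measurable_funM.
- rewrite [X in measurable_fun _ X](_ : _ =
    (fun x => complex.Re (F x) * complex.Im (G x)
            + complex.Im (F x) * complex.Re (G x))); last first.
    by apply/funext => x; case: (F x) => ? ?; case: (G x).
  by apply: measurable_funD; apply: measurable_funM.
Qed.

Lemma Cmeas_real d (T : measurableType d) (D : set T) (g : T -> R) :
  measurable_fun D g -> Cmeas D (fun x => (g x)%:C).
Proof. by move=> mg; split => //=; exact: measurable_cst. Qed.

Lemma Cmeas_cst d (T : measurableType d) (D : set T) z : Cmeas D (fun=> z).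
Proof. by split; exact: measurable_cst. Qed.

Lemma CmeasS d (T : measurableType d) (D E : set T) (F : T -> R[i]) :
  measurable E -> D `<=` E -> Cmeas E F -> Cmeas D F.
Proof. by move=> mE DE [mFr mFi]; split; apply: measurable_funS DE _. Qed.

Lemma Cmeas_eq d (T : measurableType d) (D : set T) (F G : T -> R[i]) :
  {in D, F =1 G} -> Cmeas D F -> Cmeas D G.
Proof.
by move=> FG [mFr mFi]; split; [apply: eq_measurable_fun mFr|
  apply: eq_measurable_fun mFi] => x xD; rewrite FG.
Qed.

Lemma Cmeas_norm1 d (T : measurableType d) (D : set T) (F : T -> R[i]) :
  Cmeas D F -> measurable_fun D (norm1 \o F).
Proof.
by move=> [mFr mFi]; apply: measurable_funD; apply: measurableT_comp.
Qed.

Lemma Cmeas_sum d (T : measurableType d) (D : set T) (J : Type) (s : seq J)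
    (F : J -> T -> R[i]) :
  (forall i, Cmeas D (F i)) -> Cmeas D (fun x => \sum_(i <- s) F i x).
Proof.
move=> mF; elim: s => [|i s ih].
  apply: Cmeas_eq (@Cmeas_cst _ _ D 0) => x _; by rewrite big_nil.
apply: Cmeas_eq (CmeasD (mF i) ih) => x _; by rewrite big_cons.
Qed.

Lemma norm1_Cintegral D F : measurable D -> Cmeas D F ->
  ((norm1 (Cintegral D F))%:E <= \int[mu]_(x in D) (norm1 (F x))%:E)%E.
Proof.
move=> mD mF; have [mFr mFi] := mF; rewrite /norm1 /Cintegral /=.
have main (g : R -> R) : measurable_fun D g ->
    (`|(\int[mu]_(x in D) g x)%R|%:E <= \int[mu]_(x in D) `|g x|%:E)%E.
  move=> mg; apply: (@le_trans _ _ `|\int[mu]_(x in D) (g x)%:E|%E).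
    (* [Rintegral] sends an infinite or undefined integral to 0, so the inequality holds for every
       measurable [g]. *)
    rewrite /Rintegral; case: (\int[mu]_(x in D) (g x)%:E)%E => //=.
    + by rewrite normr0 leey.
    + by rewrite normr0 leey.
  by apply: le_abse_integral => //; apply/measurable_EFinP.
rewrite EFinD.
under eq_integral do rewrite EFinD.
rewrite ge0_integralD//; last 2 first.
- by apply/measurable_EFinP; apply: measurableT_comp.
- by apply/measurable_EFinP; apply: measurableT_comp.
by apply: leeD; exact: main.
Qed.

Lemma Cintegrable D F : measurable D -> Cmeas D F ->
  (\int[mu]_(x in D) (norm1 (F x))%:E < +oo)%E ->
  mu.-integrable D (EFin \o (fun x => complex.Re (F x))) /\
  mu.-integrable D (EFin \o (fun x => complex.Im (F x))).
Proof.
move=> mD mF iF; have [mFr mFi] := mF.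
have h : mu.-integrable D (EFin \o (norm1 \o F)).
  apply/integrableP; split; first by apply/measurable_EFinP; exact: Cmeas_norm1.
  by under eq_integral do rewrite /= ger0_norm ?norm1_ge0//.
split; apply: le_integrable h => //; do ?exact/measurable_EFinP.
- by move=> x _; rewrite /= lee_fin [leRHS]ger0_norm ?norm1_ge0// lerDl.
- by move=> x _; rewrite /= lee_fin [leRHS]ger0_norm ?norm1_ge0// lerDr.
Qed.

Lemma CintegralB D F G : measurable D -> Cmeas D F -> Cmeas D G ->
  (\int[mu]_(x in D) (norm1 (F x))%:E < +oo)%E ->
  (\int[mu]_(x in D) (norm1 (G x))%:E < +oo)%E ->
  Cintegral D F - Cintegral D G = Cintegral D (fun x => F x - G x).
Proof.
move=> mD mF mG iF iG.
have [Fr Fi] := Cintegrable mD mF iF; have [Gr Gi] := Cintegrable mD mG iG.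
rewrite /Cintegral; apply/eqP; rewrite eq_complex /= -!RintegralB//.
apply/andP; split; apply/eqP; apply: eq_Rintegral => x _;
  by case: (F x) => ? ?; case: (G x).
Qed.

Lemma eq_Cintegral D F G : {in D, F =1 G} -> Cintegral D F = Cintegral D G.
Proof.
by move=> FG; rewrite /Cintegral; congr (_ +i* _); apply: eq_Rintegral => x xD;
  rewrite FG.
Qed.

(** * Reflection of the integration variable and measurability of Volterra integrals *)

Lemma lebesgue_measure_reflect (x : R) (A : set R) : measurable A ->
  pushforward mu ((fun t => x - t) : _ -> measurableTypeR R) A = mu A.
Proof.
move=> mA; apply/esym/lebesgue_measure_unique => //.
  exact: measurable_funB.
(* It is enough to compare half-open intervals; reflection turns ]a, b] into [x - b, x - a[, of the
   same length. *)
move=> mphi _ [[a b]] _ <-.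
transitivity (mu `[x - b, x - a[%classic); last first.
  congr (mu _); apply/seteqP; split => t /=; rewrite !in_itv /=; lra.
rewrite !lebesgue_measure_itv/= !lte_fin ltrD2l ltrN2; case: ifPn => // _.
by rewrite -!EFinB; congr (_%:E); ring.
Qed.

Lemma integral_reflect (x : R) (g : R -> \bar R) :
  measurable_fun `]0, x[ g -> (forall t, `]0, x[%classic t -> (0 <= g t)%E) ->
  (\int[mu]_(t in `]0%R, x[) g (x - t)%R = \int[mu]_(t in `]0%R, x[) g t)%E.
Proof.
move=> mg g0; pose phi t : measurableTypeR R := x - t.
rewrite [in LHS](_ : `]0, x[%classic = phi @^-1` `]0, x[%classic); last first.
  by apply/seteqP; split => t /=; rewrite !in_itv /= /phi; lra.
have mphi : measurable_fun setT (phi : measurableTypeR R -> measurableTypeR R).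
  exact: measurable_funB.
rewrite -(@ge0_integral_pushforward _ _ _ _ _ _ mphi mu)//.
  by apply: eq_measure_integral => A mA _; exact: lebesgue_measure_reflect.
by move=> y /set_mem; exact: g0.
Qed.

Lemma Cmeas_patch d (T : measurableType d) (D : set T) (F : T -> R[i]) :
  measurable D -> Cmeas D F -> Cmeas setT (patch (fun=> 0) D F).
Proof.
move=> mD [mFr mFi]; split.
- rewrite [X in measurable_fun _ X](_ : _ = (fun x => complex.Re (F x)) \_ D).
    exact/(measurable_restrictT _ _).1.
  by apply/funext => x; rewrite /patch; case: ifP.
- rewrite [X in measurable_fun _ X](_ : _ = (fun x => complex.Im (F x)) \_ D).
    exact/(measurable_restrictT _ _).1.
  by apply/funext => x; rewrite /patch; case: ifP.
Qed.

(** Extension of the integrand by 0 outside the triangle 0 < t < x fixes the domain of integration.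
    Tonelli then handles the positive and negative parts separately, and [fine] is applied only to
    their difference. *)
Lemma measurable_Rintegral_itv (F : R * R -> R) : measurable_fun setT F ->
  measurable_fun setT (fun x : R => \int[mu]_(t in `]0, x[) F (x, t)).
Proof.
move=> mF.
pose G (z : R * R) : R := if (0 < z.2) && (z.2 < z.1) then F z else 0.
have mG : measurable_fun setT G.
  apply: measurable_fun_ifT => //.
  by apply: measurable_and; apply: measurable_fun_ltr.
rewrite (_ : (fun _ => _) = (fun x => fine
    (fubini_F mu (fun y => (EFin \o G)^\+%E y) x
   - fubini_F mu (fun y => (EFin \o G)^\-%E y) x)%E)); last first.
  apply/funext => x; rewrite Rintegral_mkcond /Rintegral integralE.
  congr (fine (_ - _)%E); apply: eq_integral => t _.
    by rewrite !funeposE /patch /G /= mem_setE in_itv.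
  by rewrite !funenegE /patch /G /= mem_setE in_itv.
apply: measurableT_comp; first exact: fine_measurable.
apply: emeasurable_funB; apply: measurable_fun_fubini_tonelli_F => //.
- by apply: measurable_funepos; apply/measurable_EFinP.
- by apply: measurable_funeneg; apply/measurable_EFinP.
Qed.

Lemma Cmeas_Cintegral_itv (F : R * R -> R[i]) : Cmeas setT F ->
  Cmeas setT (fun x : R => Cintegral `]0, x[ (fun t => F (x, t))).
Proof.
move=> [mFr mFi]; split => /=.
- exact: (measurable_Rintegral_itv mFr).
- exact: (measurable_Rintegral_itv mFi).
Qed.

Lemma Cmeas_comp d d' (T : measurableType d) (U : measurableType d')
    (F : U -> R[i]) (g : T -> U) :
  measurable_fun setT g -> Cmeas setT F -> Cmeas setT (F \o g).
Proof.
move=> mg [mFr mFi]; split.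
- exact: (measurableT_comp mFr mg).
- exact: (measurableT_comp mFi mg).
Qed.

Local Notation I := (`]0, pi[%classic : set R).

Lemma mem_itv0 (x t : R) : `]0, x[%classic t <-> 0 < t < x.
Proof. by rewrite /= in_itv /=. Qed.

Lemma itvS (x : R) : I x -> `]0, x[ `<=` I.
Proof. by rewrite mem_itv0 => xI t; rewrite !mem_itv0 => tx; lra. Qed.

(** [F] and [G] are measurable on [I] only, so they are extended by 0; for 0 < t < x < pi both
    arguments stay in [I] and the integral is unchanged. *)
Lemma Cmeas_Vconv (F G : R -> R[i]) :
  Cmeas I F -> Cmeas I G -> Cmeas I (Vconv F G).
Proof.
move=> mF mG.
pose K (z : R * R) := patch (fun=> 0) I F (z.1 - z.2) * patch (fun=> 0) I G z.2.
have mK : Cmeas setT (K : R * R -> R[i]).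
  apply: CmeasM.
    apply: (@Cmeas_comp _ _ _ _ _ (fun z : R * R => z.1 - z.2)).
      exact: measurable_funB.
    exact: Cmeas_patch.
  by apply: (@Cmeas_comp _ _ _ _ _ snd) => //; exact: Cmeas_patch.
have := CmeasS (D := I) measurableT (@subsetT _ _) (Cmeas_Cintegral_itv mK).
apply: Cmeas_eq => x /set_mem/mem_itv0 xI; apply: eq_Cintegral => t.
move=> /set_mem/mem_itv0 tx.
by rewrite /K /patch !mem_set//; apply/mem_itv0 => /=; lra.
Qed.

Lemma Cmeas_Vpow (N : R -> R[i]) nu : Cmeas I N -> Cmeas I (Vpow N nu).
Proof.
move=> mN; rewrite /Vpow; elim: nu.-1 => [//|k ih].
by rewrite iterS; exact: Cmeas_Vconv.
Qed.

(** The case nu = 0 is excluded because [nu.-1] truncates: [Vpow N 0] and [Vpow N 1] are both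
    [N]. *)
Lemma VpowS (N : R -> R[i]) nu : (0 < nu)%N ->
  Vpow N nu.+1 = Vconv N (Vpow N nu).
Proof. by case: nu. Qed.

Lemma ae_impl (P Q : R -> Prop) : (forall x, P x -> Q x) ->
  {ae mu, forall x, P x} -> {ae mu, forall x, Q x}.
Proof.
by move=> PQ; exact: (@filterS _ _ (ae_filter_ringOfSetsType mu) _ _ PQ).
Qed.

Lemma ae_impl2 (P Q S : R -> Prop) : (forall x, P x -> Q x -> S x) ->
  {ae mu, forall x, P x} -> {ae mu, forall x, Q x} -> {ae mu, forall x, S x}.
Proof.
by move=> PQ; exact: (@filterS2 _ _ (ae_filter_ringOfSetsType mu) _ _ _ PQ).
Qed.

(** * Weighted convolution estimates *)

Lemma measurable_reflect (x : R) (g : R -> R) : I x -> measurable_fun I g ->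
  measurable_fun `]0, x[ (fun t => g (x - t)).
Proof.
move=> /mem_itv0 xI mg.
have mphi : measurable_fun `]0, x[ (fun t : R => x - t).
  exact: measurable_funB.
apply: (measurable_comp _ _ mg mphi) => //.
by move=> _ [t /mem_itv0 tx <-]; apply/mem_itv0; lra.
Qed.

Lemma Cmeas_reflect (x : R) (F : R -> R[i]) : I x -> Cmeas I F ->
  Cmeas `]0, x[ (fun t => F (x - t)).
Proof.
move=> xI [mFr mFi]; split; first exact: (measurable_reflect xI mFr).
exact: (measurable_reflect xI mFi).
Qed.

Definition rconv (g h : R -> R) (x : R) : \bar R :=
  \int[mu]_(t in `]0%R, x[) (g (x - t) * h t)%:E.

Section rconv.
Variables (g h : R -> R).
Hypotheses (mg : measurable_fun I g) (mh : measurable_fun I h).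
Hypotheses (g0 : forall x, I x -> 0 <= g x) (h0 : forall x, I x -> 0 <= h x).

Lemma measurable_rconv x : I x ->
  measurable_fun `]0, x[ (fun t => (g (x - t) * h t)%:E).
Proof.
move=> xI; apply/measurable_EFinP/measurable_funM.
  exact: measurable_reflect.
by apply: measurable_funS mh => //; exact: itvS.
Qed.

Lemma rconv_integrand_ge0 x t : I x -> `]0, x[%classic t ->
  0 <= g (x - t) * h t.
Proof.
move=> /mem_itv0 xI /mem_itv0 tx; rewrite mulr_ge0 ?g0 ?h0//; apply/mem_itv0;
  lra.
Qed.

(** Serves the cases in which the sup bound sits on the left factor, since [rconv_le] takes it on
    the right one. *)
Lemma rconvC x : I x -> rconv g h x = rconv h g x.
Proof.
move=> xI; rewrite /rconv -integral_reflect.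
- by apply: eq_integral => t _; rewrite subKr mulrC.
- exact: measurable_rconv.
- by move=> t tx; rewrite lee_fin rconv_integrand_ge0.
Qed.

(** Young's inequality for L1 against L-infinity. A bound on [h] almost everywhere yields a bound at
    every [x], which is how estimates on null-set classes become pointwise. *)
Lemma rconv_le x (c : R) : I x -> 0 <= c ->
  {ae mu, forall t, I t -> h t <= c} ->
  (rconv g h x <= c%:E * \int[mu]_(t in I) (g t)%:E)%E.
Proof.
move=> xI c0 hc.
have mgx : measurable_fun `]0, x[ (EFin \o g).
  by apply/measurable_EFinP; apply: measurable_funS mg => //; exact: itvS.
have gx0 t : `]0, x[%classic t -> 0 <= g t by move=> /(itvS xI)/g0.
apply: (@le_trans _ _ (c%:E * \int[mu]_(t in `]0%R, x[) (g t)%:E)%E); last first.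
  apply: lee_wpmul2l; first by rewrite lee_fin.
  apply: ge0_subset_integral => //; first exact/measurable_EFinP.
  exact: itvS.
rewrite -integral_reflect//.
have gr0 t : `]0, x[%classic t -> 0 <= g (x - t).
  by move: xI => /mem_itv0 xI /mem_itv0 tx; rewrite g0//; apply/mem_itv0; lra.
rewrite -ge0_integralZl_EFin//; last first.
  by apply/measurable_EFinP; exact: measurable_reflect.
apply: ae_ge0_le_integral => //.
- by move=> t tx; rewrite lee_fin rconv_integrand_ge0.
- exact: measurable_rconv.
- by move=> t tx; rewrite mule_ge0// lee_fin// gr0.
- apply: measurable_funeM; apply/measurable_EFinP; exact: measurable_reflect.
- apply: ae_impl hc => t hc tx; rewrite -EFinM lee_fin mulrC ler_wpM2r ?gr0//.
  by apply: hc; exact: itvS tx.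
Qed.

End rconv.

(** AM-GM takes the place of Cauchy-Schwarz: g(x-t) g(t) is at most half the sum of the two squares,
    and by reflection these have the same integral. *)
Lemma rconv_sqr (g : R -> R) x : measurable_fun I g ->
  (forall x, I x -> 0 <= g x) -> I x ->
  (rconv g g x <= \int[mu]_(t in I) (g t ^+ 2)%:E)%E.
Proof.
move=> mg g0 xI.
have mg2 : measurable_fun I (fun t => g t ^+ 2) by exact: measurable_funX.
have mg2x : measurable_fun `]0, x[ (fun t => (g t ^+ 2)%:E).
  by apply/measurable_EFinP; apply: measurable_funS mg2 => //; exact: itvS.
have mr : measurable_fun `]0, x[ (fun t => (g (x - t) ^+ 2)%:E).
  by apply/measurable_EFinP; exact: (measurable_reflect xI mg2).
apply: (@le_trans _ _ (\int[mu]_(t in `]0%R, x[) (g t ^+ 2)%:E)%E); last first.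
  by apply: ge0_subset_integral => //; [exact/measurable_EFinP|
    move=> t _; rewrite lee_fin sqr_ge0 | exact: itvS].
apply: (@le_trans _ _ (\int[mu]_(t in `]0%R, x[)
   (2^-1%:E * ((g (x - t) ^+ 2)%:E + (g t ^+ 2)%:E)))%E).
  apply: ge0_le_integral => //.
  - by move=> t tx; rewrite lee_fin rconv_integrand_ge0.
  - exact: measurable_rconv.
  - by apply: measurable_funeM; exact: emeasurable_funD.
  - move=> t tx; rewrite -EFinD -EFinM lee_fin.
    have := sqr_ge0 (g (x - t) - g t); rewrite sqrrB; lra.
have sq0 t : (0 <= (g t ^+ 2)%:E)%E by rewrite lee_fin sqr_ge0.
rewrite ge0_integralZl_EFin//; last 2 first.
- by move=> t _; rewrite adde_ge0.
- exact: emeasurable_funD.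
rewrite ge0_integralD//.
rewrite (integral_reflect mg2x)//.
have := @integral_ge0 _ _ _ mu `]0, x[%classic (fun t => (g t ^+ 2)%:E)
  (fun t _ => sq0 t).
case: (\int[mu]_(t in `]0%R, x[) _)%E => //=.
- by move=> r _; rewrite -EFinD -EFinM lee_fin; lra.
- by move=> _; rewrite leey.
Qed.

(* For [F = N^{*k}] this is dominated by the k-fold convolution of
   [e^{-px} |(pi - x) N(x)|]. *)
Definition wnorm (p : R) (k : nat) (F : R -> R[i]) (x : R) : R :=
  (pi - x) ^+ k * expR (- (p * x)) * norm1 (F x).

Lemma wnorm_ge0 p k F x : I x -> 0 <= wnorm p k F x.
Proof.
move=> /mem_itv0 xI; rewrite !mulr_ge0 ?norm1_ge0 ?expR_ge0//.
by rewrite exprn_ge0//; lra.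
Qed.

Lemma measurable_weight p k (D : set R) :
  measurable_fun D (fun x : R => (pi - x) ^+ k * expR (- (p * x))).
Proof.
apply: measurable_funM; first by apply: measurable_funX; exact: measurable_funB.
apply: measurableT_comp => //; apply: measurableT_comp => //.
Qed.

Lemma measurable_wnorm p k F : Cmeas I F -> measurable_fun I (wnorm p k F).
Proof.
move=> mF; apply: measurable_funM; first exact: measurable_weight.
exact: Cmeas_norm1.
Qed.

Lemma Cmeas_conv F G x : I x -> Cmeas I F -> Cmeas I G ->
  Cmeas `]0, x[ (fun t => F (x - t) * G t).
Proof.
move=> xI mF mG; apply: CmeasM; first exact: Cmeas_reflect.
by apply: CmeasS mG => //; exact: itvS.
Qed.

Lemma wnorm_conv_le p k (F G : R -> R[i]) x t : I x -> `]0, x[%classic t ->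
  (pi - x) ^+ k.+1 * expR (- (p * x)) * norm1 (F (x - t) * G t) <=
  wnorm p 1 F (x - t) * wnorm p k G t.
Proof.
move=> /mem_itv0 xI /mem_itv0 tx; rewrite /wnorm expr1.
have -> : expR (- (p * x)) = expR (- (p * (x - t))) * expR (- (p * t)).
  by rewrite -expRD; congr expR; ring.
rewrite [leRHS](_ : _ = (pi - (x - t)) * (pi - t) ^+ k *
  (expR (- (p * (x - t))) * expR (- (p * t))) *
  (norm1 (F (x - t)) * norm1 (G t))); last by ring.
have pik : 0 <= (pi - x) ^+ k by rewrite exprn_ge0//; lra.
apply: ler_pM => //.
- by rewrite !mulr_ge0 ?expR_ge0 ?exprn_ge0//; lra.
- exact: norm1_ge0.
- rewrite ler_wpM2r ?mulr_ge0 ?expR_ge0//.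
  rewrite exprS ler_pM//; [lra|lra|].
  by rewrite lerXn2r ?nnegrE//; lra.
- exact: norm1M.
Qed.

Section Vconv_bounds.
Variables (p : R) (k : nat) (x : R).
Implicit Types (F G : R -> R[i]).
Hypothesis xI : I x.
Let c := (pi - x) ^+ k.+1 * expR (- (p * x)).

Lemma weight_gt0 : 0 < c.
Proof.
by move: xI => /mem_itv0 xI'; rewrite mulr_gt0 ?expR_gt0 ?exprn_gt0//; lra.
Qed.

(** The integral of [norm1] is bounded, and not merely the [norm1] of the integral, so that the same
    estimate also gives integrability and handles differences of convolutions. *)
Lemma weight_int_conv F G : Cmeas I F -> Cmeas I G ->
  (c%:E * \int[mu]_(t in `]0%R, x[) (norm1 (F (x - t) * G t)%R)%:E <=
   rconv (wnorm p 1 F) (wnorm p k G) x)%E.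
Proof.
move=> mF mG; have mFG := Cmeas_conv xI mF mG.
rewrite -ge0_integralZl_EFin//; last 3 first.
- by move=> t _; rewrite lee_fin norm1_ge0.
- by apply/measurable_EFinP; exact: Cmeas_norm1.
- exact/ltW/weight_gt0.
apply: ge0_le_integral => //.
- by move=> t _; rewrite -EFinM lee_fin mulr_ge0 ?norm1_ge0 ?ltW ?weight_gt0.
- by apply: measurable_funeM; apply/measurable_EFinP; exact: Cmeas_norm1.
- by apply: measurable_rconv => //; exact: measurable_wnorm.
- by move=> t tx; rewrite -EFinM lee_fin wnorm_conv_le.
Qed.

Lemma wnorm_Vconv F G : Cmeas I F -> Cmeas I G ->
  ((wnorm p k.+1 (Vconv F G) x)%:E <= rconv (wnorm p 1 F) (wnorm p k G) x)%E.
Proof.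
move=> mF mG; apply: le_trans (weight_int_conv mF mG).
rewrite /wnorm -/c EFinM lee_pmul2l ?lte_fin ?weight_gt0// norm1_Cintegral//.
exact: Cmeas_conv.
Qed.

Lemma int_conv_lty F G : Cmeas I F -> Cmeas I G ->
  (rconv (wnorm p 1 F) (wnorm p k G) x < +oo)%E ->
  (\int[mu]_(t in `]0%R, x[) (norm1 (F (x - t) * G t)%R)%:E < +oo)%E.
Proof.
move=> mF mG h; have := le_lt_trans (weight_int_conv mF mG) h.
case: (\int[mu]_(t in `]0%R, x[) _)%E => //.
- by move=> r _; rewrite ltry.
- by rewrite gt0_muley ?lte_fin ?weight_gt0.
Qed.

(** By bilinearity, F*G - F'*G' = (F - F')*G + F'*(G - G'). The two finiteness hypotheses make the
    convolution integrands integrable, so that the componentwise integrals can be subtracted. *)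
Lemma wnorm_VconvB F G (F' G' : R -> R[i]) :
  Cmeas I F -> Cmeas I G -> Cmeas I F' -> Cmeas I G' ->
  (rconv (wnorm p 1 F) (wnorm p k G) x < +oo)%E ->
  (rconv (wnorm p 1 F') (wnorm p k G') x < +oo)%E ->
  ((wnorm p k.+1 (fun y => Vconv F G y - Vconv F' G' y)%R x)%:E <=
   rconv (wnorm p 1 (fun y => F y - F' y)%R) (wnorm p k G) x +
   rconv (wnorm p 1 F') (wnorm p k (fun y => G y - G' y)%R) x)%E.
Proof.
move=> mF mG mF' mG' h h'.
have mFB := CmeasB mF mF'; have mGB := CmeasB mG mG'.
apply: le_trans; last exact:
  leeD (weight_int_conv mFB mG) (weight_int_conv mF' mGB).
rewrite -ge0_muleDr; last 2 first.
- by apply: integral_ge0 => t _; rewrite lee_fin norm1_ge0.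
- by apply: integral_ge0 => t _; rewrite lee_fin norm1_ge0.
rewrite /wnorm -/c EFinM lee_pmul2l ?lte_fin ?weight_gt0//.
rewrite -ge0_integralD//; last 4 first.
- by move=> t _; rewrite lee_fin norm1_ge0.
- by apply/measurable_EFinP; apply: Cmeas_norm1; exact: (Cmeas_conv xI mFB mG).
- by move=> t _; rewrite lee_fin norm1_ge0.
- by apply/measurable_EFinP; apply: Cmeas_norm1; exact: (Cmeas_conv xI mF' mGB).
have m1 := Cmeas_conv xI mF mG; have m2 := Cmeas_conv xI mF' mG'.
rewrite /Vconv CintegralB//; [|exact: int_conv_lty|exact: int_conv_lty].
apply: le_trans (norm1_Cintegral _ _) _ => //; first exact: CmeasB.
apply: ge0_le_integral => //.
- by move=> t _; rewrite lee_fin norm1_ge0.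
- by apply/measurable_EFinP; apply: Cmeas_norm1; exact: CmeasB.
- by apply: emeasurable_funD; apply/measurable_EFinP; apply: Cmeas_norm1;
    [exact: (Cmeas_conv xI mFB mG)|exact: (Cmeas_conv xI mF' mGB)].
- move=> t _; rewrite -EFinD lee_fin; apply: le_trans (norm1D _ _).
  by rewrite le_eqVlt; apply/orP; left; apply/eqP; congr norm1; ring.
Qed.

End Vconv_bounds.

(** * Convolution powers of a small function and their differences *)

Definition small p l (N : R -> R[i]) :=
  (\int[mu]_(t in I) (wnorm p 1 N t)%:E <= l%:E)%E /\
  (\int[mu]_(t in I) (wnorm p 1 N t ^+ 2)%:E <= (l ^+ 2)%:E)%E.

Lemma pi_ge1 : (1 : R) <= pi.
Proof. by have := pi_ge2 R; lra. Qed.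

Lemma ae_all (P : R -> Prop) : (forall x, P x) -> {ae mu, forall x, P x}.
Proof. exact: (@filterE _ _ (ae_filter_ringOfSetsType mu)). Qed.

Section Vpow_bounds.
Variables (p l : R) (N : R -> R[i]).
Hypotheses (l0 : 0 <= l) (mN : Cmeas I N) (sN : small p l N).

Local Notation w nu := (wnorm p nu (Vpow N nu)).

Let mw nu : measurable_fun I (w nu).
Proof. by apply: measurable_wnorm; exact: Cmeas_Vpow. Qed.

(** The L2 half of [small] bounds the square; each further factor multiplies the sup bound by the L1
    norm, at most [l]. The bound is on [rconv] because its finiteness later gives integrability. *)
Lemma rconv_Vpow nu x : I x ->
  (rconv (w 1) (w nu.+1) x <= (l ^+ nu.+2)%:E)%E.
Proof.
elim: nu x => [|nu ih] x xI.
  by apply: (le_trans (rconv_sqr _ _ xI) sN.2) => // t; exact: wnorm_ge0.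
apply: (@le_trans _ _ ((l ^+ nu.+2)%:E * \int[mu]_(t in I) (w 1 t)%:E)%E).
  apply: rconv_le => //.
  - by move=> t; exact: wnorm_ge0.
  - by move=> t; exact: wnorm_ge0.
  - by rewrite exprn_ge0.
  - apply: ae_all => t tI; rewrite -lee_fin; apply: le_trans (ih t tI).
    by rewrite VpowS//; apply: wnorm_Vconv => //; exact: Cmeas_Vpow.
have -> : (l ^+ nu.+3)%:E = ((l ^+ nu.+2)%:E * l%:E)%E.
  by rewrite -EFinM -exprSr.
apply: lee_wpmul2l; last exact: sN.1.
by rewrite lee_fin exprn_ge0.
Qed.

(** The powers start at 2, since the weighted [N] itself may be unbounded. *)
Lemma wnorm_Vpow nu x : I x -> w nu.+2 x <= l ^+ nu.+2.
Proof.
move=> xI; rewrite -lee_fin; apply: le_trans (rconv_Vpow nu xI).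
by rewrite VpowS//; apply: wnorm_Vconv => //; exact: Cmeas_Vpow.
Qed.

(** From the second power on, this is the sup bound times the length [pi] of [I]; the first power
    has its L1 bound, put in the same form by 1 <= pi. *)
Lemma int_wnorm_Vpow nu :
  (\int[mu]_(t in I) (w nu.+1 t)%:E <= (pi * l ^+ nu.+1)%:E)%E.
Proof.
case: nu => [|nu].
  by rewrite expr1; apply: (le_trans sN.1); rewrite lee_fin ler_peMl ?pi_ge1.
apply: (@le_trans _ _ (\int[mu]_(t in I) (cst (l ^+ nu.+2)%:E t))%E).
  apply: ge0_le_integral => //.
  - by move=> t tI; rewrite lee_fin wnorm_ge0.
  - by apply/measurable_EFinP; exact: mw.
  - by move=> t tI; rewrite lee_fin wnorm_Vpow.
rewrite integral_cst//= lebesgue_measure_itv/= lte_fin.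
by rewrite (lt_le_trans ltr01 pi_ge1) -EFinB -EFinM subr0 mulrC.
Qed.

Lemma rconv_Vpow_lty nu x : I x -> (rconv (w 1) (w nu.+1) x < +oo)%E.
Proof. by move=> xI; apply: le_lt_trans (rconv_Vpow nu xI) (ltry _). Qed.

End Vpow_bounds.

Section VpowB_bounds.
Variables (p l d : R) (N N' : R -> R[i]).
Hypotheses (l0 : 0 <= l) (d0 : 0 <= d).
Hypotheses (mN : Cmeas I N) (sN : small p l N).
Hypotheses (mN' : Cmeas I N') (sN' : small p l N').
Hypothesis NN' :
  {ae mu, forall x, I x -> wnorm p 1 (fun y => N y - N' y) x <= d}.

Local Notation wB nu :=
  (wnorm p nu (fun y => Vpow N nu y - Vpow N' nu y)).

Lemma Cmeas_VpowB nu : Cmeas I (fun y => Vpow N nu y - Vpow N' nu y).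
Proof. by apply: CmeasB; exact: Cmeas_Vpow. Qed.

(** The bilinear splitting leaves one difference in each product. The sup bounds [d] and [c] go to
    these differences, and the L1 norms to the other factors. *)
Lemma wnorm_VpowB_step nu x (c : R) : I x -> 0 <= c ->
  {ae mu, forall x, I x -> wB nu.+1 x <= c} ->
  wB nu.+2 x <= d * (pi * l ^+ nu.+1) + c * l.
Proof.
move=> xI c0 hc; rewrite -lee_fin.
have mB := Cmeas_VpowB.
have ge0 k F t : I t -> 0 <= wnorm p k F t by exact: wnorm_ge0.
have mw k F : Cmeas I F -> measurable_fun I (wnorm p k F).
  exact: measurable_wnorm.
have mV k := Cmeas_Vpow k mN; have mV' k := Cmeas_Vpow k mN'.
rewrite VpowS// (VpowS N')//.
apply: le_trans (wnorm_VconvB xI mN (mV _) mN' (mV' _) _ _) _.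
- exact: rconv_Vpow_lty l0 mN sN _ _ xI.
- exact: rconv_Vpow_lty l0 mN' sN' _ _ xI.
rewrite EFinD; apply: leeD.
- have mB1 : Cmeas I (fun y => N y - N' y) := mB 1.
  rewrite (rconvC (mw _ _ mB1) (mw _ _ (mV _)) (@ge0 _ _) (@ge0 _ _) xI).
  apply: le_trans (rconv_le (mw _ _ (mV _)) (mw _ _ mB1) (@ge0 _ _) (@ge0 _ _)
    xI d0 NN') _.
  rewrite EFinM; apply: lee_wpmul2l; first by rewrite lee_fin.
  exact: int_wnorm_Vpow.
- apply: le_trans (rconv_le (mw _ _ mN') (mw _ _ (mB _)) (@ge0 _ _) (@ge0 _ _)
    xI c0 hc) _.
  rewrite EFinM; apply: lee_wpmul2l; first by rewrite lee_fin.
  exact: sN'.1.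
Qed.

(** The recursion c_{nu+1} = l c_nu + pi d l^nu with c_1 = pi d has the solution c_nu = pi d nu
    l^(nu-1), as for the derivative of a power. *)
Lemma ae_wnorm_VpowB nu :
  {ae mu, forall x, I x -> wB nu.+1 x <= pi * d * nu.+1%:R * l ^+ nu}.
Proof.
elim: nu => [|nu ih].
  apply: ae_impl NN' => x h xI; apply: le_trans (h xI) _.
  by rewrite expr0 !mulr1 ler_peMl ?pi_ge1.
apply: ae_all => x xI; apply: le_trans (wnorm_VpowB_step xI _ ih) _.
  by rewrite !mulr_ge0 ?exprn_ge0 ?pi_ge0.
by rewrite le_eqVlt; apply/orP; left; apply/eqP;
  rewrite [l ^+ nu.+1]exprS -[nu.+2%:R]natr1; ring.
Qed.

Lemma wnorm_VpowB nu x : I x ->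
  wB nu.+2 x <= pi * d * nu.+2%:R * l ^+ nu.+1.
Proof.
move=> xI; apply: le_trans (wnorm_VpowB_step xI _ (ae_wnorm_VpowB nu)) _.
  by rewrite !mulr_ge0 ?exprn_ge0 ?pi_ge0.
by rewrite le_eqVlt; apply/orP; left; apply/eqP;
  rewrite [l ^+ nu.+1]exprS -[nu.+2%:R]natr1; ring.
Qed.

End VpowB_bounds.

(** * Geometrically convergent sequences *)

Definition norm1_cvg (s : nat -> R[i]) (a : R[i]) :=
  (fun n => norm1 (s n - a)) @ \oo --> 0.

Lemma norm1_cvgP (s : nat -> R[i]) a : norm1_cvg s a <->
  (fun n => s n : R[i]^o) @ \oo --> (a : R[i]^o).
Proof.
split => [sa|/cvgrPdist_lt sa].
(* The order on [R[i]] compares only numbers with equal imaginary parts, so a positive radius is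
   real. *)
- apply/cvgrPdist_lt => -[e1 e2]; rewrite ltcE /= => /andP[/eqP -> e0].
  have /cvgrPdist_lt/(_ _ e0) := sa.
  apply: filterS => n; rewrite sub0r normrN ger0_norm ?norm1_ge0// => h.
  rewrite normc_def ltcR -/(ComplexField.Normc.normc _).
  apply: le_lt_trans h; rewrite norm1C.
  apply: le_trans (normc_le_norm1 _); rewrite /ComplexField.Normc.normc.
  by case: (a - s n).
- apply/cvgrPdist_lt => e e0.
  (* Half the radius suffices, [norm1] being at most sqrt 2 times the modulus. *)
  have e20 : (0 : R[i]) < (e / 2)%:C by rewrite ltcR; lra.
  have := sa _ e20; apply: filterS => n.
  rewrite normc_def ltcR sub0r normrN ger0_norm ?norm1_ge0// norm1C => h.
  have := norm1_sqr_le (a - s n).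
  have : ComplexField.Normc.normc (a - s n) < e / 2.
    by move: h; case: (a - s n).
  have := norm1_ge0 (a - s n).
  have : 0 <= ComplexField.Normc.normc (a - s n).
    by case: (a - s n) => ? ?; exact: sqrtr_ge0.
  nra.
Qed.

Lemma norm1_cvgB s s' a a' : norm1_cvg s a -> norm1_cvg s' a' ->
  norm1_cvg (fun n => s n - s' n) (a - a').
Proof.
move=> sa sa'.
have h : (fun n => norm1 (s n - a) + norm1 (s' n - a')) @ \oo --> 0.
  by rewrite -[0]addr0; exact: cvgD.
apply: (squeeze_cvgr _ (cvg_cst 0) h); apply: nearW => n; rewrite norm1_ge0 /=.
apply: le_trans (norm1B _ _).
by rewrite le_eqVlt; apply/orP; left; apply/eqP; congr norm1; ring.
Qed.

Lemma norm1_cvg_le s a (B : R) : norm1_cvg s a ->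
  (\forall n \near \oo, norm1 (s n) <= B) -> norm1 a <= B.
Proof.
move=> sa sB.
have h : (fun n => B + norm1 (s n - a)) @ \oo --> B.
  by rewrite -[X in _ --> X]addr0; apply: cvgD => //; exact: cvg_cst.
apply: (cvgr_to_ge h); apply: filterS sB => n sB /=.
rewrite [in leLHS](_ : a = s n - (s n - a)); last by ring.
by apply: le_trans (norm1B _ _) _; rewrite lerD2r.
Qed.

Lemma norm1_cvg_unique s a a' : norm1_cvg s a -> norm1_cvg s a' -> a = a'.
Proof.
move=> sa sa'; apply/eqP; rewrite -subr_eq0; apply/eqP/norm1_eq0.
apply: norm1_cvg_le (norm1_cvgB sa sa') _; apply: nearW => n.
by rewrite subrr norm10.
Qed.

(** A total function, so that the remainder of the series can be defined for every [N] before
    convergence is known. *)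
Definition clim (s : nat -> R[i]) : R[i] :=
  limn (fun n => complex.Re (s n)) +i* limn (fun n => complex.Im (s n)).

Lemma cvg_geometric_increments (u : nat -> R) (B : R) :
  (forall n, `|u n.+1 - u n| <= B * (1 / 2) ^+ n) -> cvgn u.
Proof.
move=> uB; rewrite (_ : u = (fun n => u 0%N + series (telescope u) n)); last first.
  by apply/funext => n; exact: eq_sum_telescope.
apply: is_cvgD; first exact: is_cvg_cst.
apply: normed_cvg; apply: (@series_le_cvg _ _ (geometric B (1 / 2))) => //=.
- by move=> n; apply: le_trans (uB n).
- by apply: is_cvg_geometric_series; rewrite ger0_norm; lra.
Qed.

Lemma norm1_cvg_clim s (B : R) :
  (forall n, norm1 (s n.+1 - s n) <= B * (1 / 2) ^+ n) -> norm1_cvg s (clim s).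
Proof.
move=> sB.
have cr : cvgn (fun n => complex.Re (s n)).
  apply: (@cvg_geometric_increments _ B) => n; apply: le_trans (sB n).
  by case: (s n) (s n.+1) => a b [a' b']; rewrite /norm1 /= lerDl.
have ci : cvgn (fun n => complex.Im (s n)).
  apply: (@cvg_geometric_increments _ B) => n; apply: le_trans (sB n).
  by case: (s n) (s n.+1) => a b [a' b']; rewrite /norm1 /= lerDr.
set a := limn (fun n => complex.Re (s n)) in cr *.
set b := limn (fun n => complex.Im (s n)) in ci *.
have h : (fun n => `|complex.Re (s n) - a| + `|complex.Im (s n) - b|) @ \oo --> 0.
  rewrite -[X in _ --> X]addr0 -[X in _ --> X + _](normr0 R).
  rewrite -[X in _ --> _ + X](normr0 R).
  by apply: cvgD; apply: cvg_norm; apply/subr_cvg0.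
apply: cvg_trans h; apply: near_eq_cvg.
by apply: nearW => n; rewrite /norm1 /clim /=; case: (s n).
Qed.

(** The right side is the exact sum of the geometric increments, so the induction closes with an
    equality. *)
Lemma norm1_geometric_le s (B : R) n m : 0 <= B ->
  (forall n, norm1 (s n.+1 - s n) <= B * (1 / 2) ^+ n) -> (n <= m)%N ->
  norm1 (s m - s n) <= 2 * B * ((1 / 2) ^+ n - (1 / 2) ^+ m).
Proof.
move=> B0 sB; elim: m => [|m ih].
  by rewrite leqn0 => /eqP ->; rewrite !subrr norm10 mulr0.
rewrite leq_eqVlt => /orP[/eqP <-|]; first by rewrite !subrr norm10 mulr0.
rewrite ltnS => /ih h.
rewrite (_ : s m.+1 - s n = (s m.+1 - s m) + (s m - s n)); last by ring.
apply: le_trans (norm1D _ _) _; apply: le_trans (lerD (sB m) h) _.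
by rewrite exprS le_eqVlt; apply/orP; left; apply/eqP; field.
Qed.

Lemma clim_geometric_le s (B : R) n : 0 <= B ->
  (forall n, norm1 (s n.+1 - s n) <= B * (1 / 2) ^+ n) ->
  norm1 (clim s - s n) <= 2 * B * (1 / 2) ^+ n.
Proof.
move=> B0 sB.
have c : norm1_cvg (fun=> s n) (s n).
  by rewrite /norm1_cvg subrr norm10; exact: cvg_cst.
apply: norm1_cvg_le (norm1_cvgB (norm1_cvg_clim sB) c) _.
near=> m; apply: le_trans (norm1_geometric_le B0 sB _) _.
  by near: m; exact: nbhs_infty_ge.
rewrite ler_wpM2l ?mulr_ge0// lerBlDr lerDl exprn_ge0//; lra.
Unshelve. all: by end_near. Qed.

Lemma Cmeas_clim d (T : measurableType d) (D : set T) (s : T -> nat -> R[i])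
    (B : T -> R) : (forall n, Cmeas D (s ^~ n)) ->
  (forall x n, D x -> norm1 (s x n.+1 - s x n) <= B x * (1 / 2) ^+ n) ->
  Cmeas D (fun x => clim (s x)).
Proof.
move=> ms sB; split.
- apply: (@measurable_fun_cvg _ _ _ _ (fun n x => complex.Re (s x n))).
    by move=> n; exact: (ms n).1.
  move=> x Dx; apply: (@cvg_geometric_increments _ (B x)) => n.
  apply: le_trans (sB x n Dx).
  by case: (s x n) (s x n.+1) => a b [a' b']; rewrite /norm1 /= lerDl.
- apply: (@measurable_fun_cvg _ _ _ _ (fun n x => complex.Im (s x n))).
    by move=> n; exact: (ms n).2.
  move=> x Dx; apply: (@cvg_geometric_increments _ (B x)) => n.
  apply: le_trans (sB x n Dx).
  by case: (s x n) (s x n.+1) => a b [a' b']; rewrite /norm1 /= lerDr.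
Qed.

(** * The kernels and the nonlinear remainder *)

Section kernel.
Variables h H : R[i].

(** With x - t <= pi - t <= 4 and nu <= nu!, the last factor of [Psi] is at most (pi - t) (2 + 4
    |H|) nu!; its pi - t raises (pi - t)^(nu-1) to the power nu. *)
Definition Psi_bound : R := norm1 H + norm1 h * (2 + 4 * norm1 H).

Lemma Psi_bound_ge0 : 0 <= Psi_bound.
Proof.
by rewrite addr_ge0 ?mulr_ge0 ?norm1_ge0// addr_ge0 ?mulr_ge0 ?norm1_ge0.
Qed.

Lemma pi_le4 : (pi : R) <= 4.
Proof. by have := pihalf_lt2 R; lra. Qed.

Lemma norm1_Psi nu x t : I x -> `]0, x[%classic t ->
  norm1 (Psi h H nu.+1 x t) <= Psi_bound * (pi - t) ^+ nu.+1.
Proof.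
move=> /mem_itv0 xI /mem_itv0 tx; rewrite /Psi /Psi_bound.
have f0 : (0 : R) < (nu.+1)`!%:R by rewrite ltr0n fact_gt0.
have -> : ((nu.+1)`!%:R : R[i])^-1 = ((nu.+1)`!%:R^-1 : R)%:C.
  by rewrite fmorphV rmorph_nat.
rewrite norm1Zl ger0_norm ?invr_ge0 ?(ltW f0)// [leLHS]mulrC ler_pdivrMr//.
have q0 : 0 <= (pi - t) ^+ nu by rewrite exprn_ge0//; lra.
have nH := norm1_ge0 H; have nh := norm1_ge0 h.
have pit : (pi - x) ^+ nu.+1 <= (pi - t) ^+ nu.+1.
  by rewrite lerXn2r ?nnegrE//; lra.
have nuf : nu.+1%:R <= ((nu.+1)`!%:R : R) by rewrite ler_nat; exact: fact_geq.
have f1 : 1 <= ((nu.+1)`!%:R : R) by rewrite ler1n fact_gt0.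
have h1 : norm1 (H * ((pi - x) ^+ nu.+1)%:C) <=
    norm1 H * (pi - t) ^+ nu.+1 * (nu.+1)`!%:R.
  apply: le_trans (norm1M _ _) _; rewrite norm1_real ger0_norm; last first.
    by rewrite exprn_ge0//; lra.
  rewrite -[leLHS]mulr1 ler_pM ?mulr_ge0 ?exprn_ge0//; [lra|].
  by rewrite ler_wpM2l.
have h2 : norm1 ((pi - t)%:C + (x - t)%:C * (nu.+1%:R + H * (pi - t)%:C)) <=
    (pi - t) * (2 + 4 * norm1 H) * (nu.+1)`!%:R.
  apply: le_trans (norm1D _ _) _.
  have : norm1 (nu.+1%:R + H * (pi - t)%:C) <= (nu.+1)`!%:R + norm1 H * 4.
    apply: le_trans (norm1D _ _) _; apply: lerD.
      have -> : (nu.+1%:R : R[i]) = (nu.+1%:R : R)%:C by rewrite rmorph_nat.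
      by rewrite norm1_real ger0_norm.
    apply: le_trans (norm1M _ _) _; rewrite norm1_real ger0_norm; last by lra.
    by have := pi_le4; nra.
  have n0 := norm1_ge0 (nu.+1%:R + H * (pi - t)%:C).
  rewrite norm1Zl norm1_real !ger0_norm; [|lra|lra].
  move=> h3; have : (x - t) * norm1 (nu.+1%:R + H * (pi - t)%:C) <=
      (pi - t) * ((nu.+1)`!%:R + norm1 H * 4) by apply: ler_pM => //; lra.
  have : (pi - t) * norm1 H <= (pi - t) * norm1 H * (nu.+1)`!%:R.
    by rewrite ler_peMr// mulr_ge0//; lra.
  have : (pi - t) <= (pi - t) * (nu.+1)`!%:R by rewrite ler_peMr//; lra.
  lra.
apply: le_trans (norm1D _ _) _; rewrite mulrDl mulrDl; apply: lerD => //.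
apply: le_trans (norm1M _ _) _.
have h4 : norm1 (h * ((pi - t) ^+ nu)%:C) <= norm1 h * (pi - t) ^+ nu.
  by apply: le_trans (norm1M _ _) _; rewrite norm1_real ger0_norm.
rewrite [leRHS](_ : _ = (norm1 h * (pi - t) ^+ nu) *
  ((pi - t) * (2 + 4 * norm1 H) * (nu.+1)`!%:R)); last by rewrite exprS; ring.
by apply: ler_pM => //; exact: norm1_ge0.
Qed.

Lemma Cmeas_Psi nu : Cmeas setT (fun y : R * R => Psi h H nu y.1 y.2).
Proof.
rewrite /Psi; apply: CmeasM; first exact: Cmeas_cst.
have mt : measurable_fun setT (fun y : R * R => pi - y.2).
  exact: measurable_funB.
have mx : measurable_fun setT (fun y : R * R => pi - y.1).
  exact: measurable_funB.
apply: CmeasD.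
  apply: CmeasM; first exact: Cmeas_cst.
  by apply: Cmeas_real; exact: measurable_funX.
apply: CmeasM.
  apply: CmeasM; first exact: Cmeas_cst.
  by apply: Cmeas_real; exact: measurable_funX.
apply: CmeasD; first exact: Cmeas_real.
apply: CmeasM; first by apply: Cmeas_real; exact: measurable_funB.
apply: CmeasD; first exact: Cmeas_cst.
by apply: CmeasM; [exact: Cmeas_cst|exact: Cmeas_real].
Qed.

Lemma Cmeas_Psi_itv nu x (F : R -> R[i]) : I x -> Cmeas I F ->
  Cmeas `]0, x[ (fun t => Psi h H nu x t * F t).
Proof.
move=> xI mF; apply: CmeasM.
  apply: (CmeasS measurableT (@subsetT _ _)).
  apply: (@Cmeas_comp _ _ _ _ (fun y : R * R => Psi h H nu y.1 y.2)
    (fun t : R => (x, t))); last exact: Cmeas_Psi.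
  exact: measurable_pair1.
by apply: CmeasS mF => //; exact: itvS.
Qed.

Definition Psi_int nu (F : R -> R[i]) x : R[i] :=
  Cintegral `]0, x[ (fun t => Psi h H nu x t * F t).

Lemma Cmeas_Psi_int nu (F : R -> R[i]) : Cmeas I F -> Cmeas I (Psi_int nu F).
Proof.
move=> mF.
pose K (y : R * R) := Psi h H nu y.1 y.2 * patch (fun=> 0) I F y.2.
have mK : Cmeas setT K.
  apply: CmeasM; first exact: Cmeas_Psi.
  by apply: (@Cmeas_comp _ _ _ _ _ snd) => //; exact: Cmeas_patch.
have := CmeasS (D := I) measurableT (@subsetT _ _) (Cmeas_Cintegral_itv mK).
apply: Cmeas_eq => x /set_mem xI; apply: eq_Cintegral => t /set_mem tx.
by rewrite /K /patch /= mem_set//; exact: itvS tx.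
Qed.

Definition expw (p x : R) : R := expR (- (p * x)).

Lemma measurable_expw p D : measurable_fun D (expw p).
Proof.
by apply: measurableT_comp => //; apply: measurableT_comp.
Qed.

(** Once the kernel is bounded, e^{-px} = e^{-p(x-t)} e^{-pt} leaves a convolution with [expw p].
    Young's inequality then applies either way: [expw p] may enter through its sup bound 1 or
    through its small L1 norm. *)
Lemma Psi_int_conv nu p x (F : R -> R[i]) : I x -> Cmeas I F ->
  ((expw p x)%:E * \int[mu]_(t in `]0%R, x[) (norm1 (Psi h H nu.+1 x t * F t)%R)%:E
   <= Psi_bound%:E * rconv (expw p) (wnorm p nu.+1 F) x)%E.
Proof.
move=> xI mF; have mPF := Cmeas_Psi_itv nu.+1 xI mF.
have e0 y : 0 <= expw p y by exact: expR_ge0.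
have mr : measurable_fun `]0, x[
    (fun t => (expw p (x - t) * wnorm p nu.+1 F t)%:E).
  apply: measurable_rconv => //; first exact: measurable_expw.
  exact: measurable_wnorm.
have r0 t : `]0, x[%classic t ->
    (0 <= (expw p (x - t) * wnorm p nu.+1 F t)%:E)%E.
  by move=> tx; rewrite lee_fin mulr_ge0// wnorm_ge0//; exact: itvS tx.
rewrite -ge0_integralZl_EFin//; last 2 first.
- by move=> t _; rewrite lee_fin norm1_ge0.
- by apply/measurable_EFinP; exact: Cmeas_norm1.
rewrite /rconv -ge0_integralZl_EFin//; last exact: Psi_bound_ge0.
apply: ge0_le_integral => //.
- by move=> t _; rewrite -EFinM lee_fin mulr_ge0 ?norm1_ge0.
- by apply: measurable_funeM; apply/measurable_EFinP; exact: Cmeas_norm1.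
- exact: measurable_funeM.
move=> t tx; rewrite -!EFinM lee_fin /wnorm.
rewrite (_ : expw p x = expw p (x - t) * expw p t); last first.
  by rewrite /expw -expRD; congr expR; ring.
rewrite [leRHS](_ : _ = (expw p (x - t) * expw p t) *
  (Psi_bound * (pi - t) ^+ nu.+1 * norm1 (F t))); last by rewrite /expw; ring.
rewrite ler_wpM2l ?mulr_ge0//; apply: le_trans (norm1M _ _) _.
by rewrite ler_wpM2r ?norm1_ge0// norm1_Psi.
Qed.

Lemma norm1_Psi_int nu p x (F : R -> R[i]) : I x -> Cmeas I F ->
  ((expw p x * norm1 (Psi_int nu.+1 F x))%:E
   <= Psi_bound%:E * rconv (expw p) (wnorm p nu.+1 F) x)%E.
Proof.
move=> xI mF; apply: le_trans (Psi_int_conv nu p xI mF).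
rewrite EFinM; apply: lee_wpmul2l; first by rewrite lee_fin expR_ge0.
by apply: norm1_Cintegral => //; exact: Cmeas_Psi_itv.
Qed.

Lemma norm1_Psi_intB nu p x (F G : R -> R[i]) : I x -> Cmeas I F -> Cmeas I G ->
  (rconv (expw p) (wnorm p nu.+1 F) x < +oo)%E ->
  (rconv (expw p) (wnorm p nu.+1 G) x < +oo)%E ->
  ((expw p x * norm1 (Psi_int nu.+1 F x - Psi_int nu.+1 G x))%:E
   <= Psi_bound%:E * rconv (expw p) (wnorm p nu.+1 (fun y => F y - G y)%R) x)%E.
Proof.
move=> xI mF mG.
have lty (K : R -> R[i]) : Cmeas I K ->
    (rconv (expw p) (wnorm p nu.+1 K) x < +oo)%E ->
    (\int[mu]_(t in `]0%R, x[) (norm1 (Psi h H nu.+1 x t * K t)%R)%:E < +oo)%E.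
  move=> mK hK; have := Psi_int_conv nu p xI mK.
  have : (Psi_bound%:E * rconv (expw p) (wnorm p nu.+1 K) x < +oo)%E.
    move: hK; have : (0 <= rconv (expw p) (wnorm p nu.+1 K) x)%E.
      apply: integral_ge0 => t tx; rewrite lee_fin mulr_ge0 ?expR_ge0//.
      by rewrite wnorm_ge0//; exact: itvS tx.
    by case: (rconv _ _ _) => // r _ _; rewrite -EFinM ltry.
  move=> /[swap]/le_lt_trans/[apply].
  case: (\int[mu]_(t in `]0%R, x[) _)%E => //.
  - by move=> r _; rewrite ltry.
  - by rewrite gt0_muley// lte_fin expR_gt0.
move=> /(lty _ mF) iF /(lty _ mG) iG.
rewrite /Psi_int CintegralB//; [|exact: Cmeas_Psi_itv|exact: Cmeas_Psi_itv].
rewrite (_ : Cintegral _ _ = Psi_int nu.+1 (fun y => F y - G y) x); last first.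
  by apply: eq_Cintegral => t _; rewrite mulrBr.
by apply: norm1_Psi_int => //; exact: CmeasB.
Qed.

End kernel.

Lemma le_half (l : R) : l <= 1 / 64 -> l <= 1 / 2.
Proof. lra. Qed.

(** For k = 0 only the linear integral term is left, and pi <= 4 with c e <= 1/16 gives d / 4. For k
    > 0, k + 1 <= 2^k and 2 l <= 1/32 leave a factor 1/16 beyond the required 2^(-k), which covers
    both terms. *)
Lemma lipschitz_coef_le (l d c e : R) k : 0 <= l -> l <= 1 / 64 -> 0 <= d ->
  0 <= c -> 0 <= e -> c * e <= 1 / 16 ->
  (if k == 0%N then 0 else pi * d * l ^+ k) +
  c * (pi * d * k.+1%:R * l ^+ k * e) <= d / 4 * (1 / 2) ^+ k.
Proof.
move=> l0 l64 d0 C0 e0 Ce.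
have pi0 := pi_ge0 R; have pi4 := pi_le4.
have lk : 0 <= l ^+ k by exact: exprn_ge0.
have k2 : k.+1%:R <= (2 ^+ k : R) by rewrite -natrX ler_nat ltn_expl.
have k20 : (0 : R) <= 2 ^+ k by rewrite exprn_ge0.
have a2 : c * (pi * d * k.+1%:R * l ^+ k * e) <= d / 4 * (2 ^+ k * l ^+ k).
  rewrite (_ : c * _ = (c * e) * pi * (k.+1%:R * l ^+ k) * d); last by ring.
  rewrite (_ : d / 4 * _ = 1 / 16 * 4 * (2 ^+ k * l ^+ k) * d); last by field.
  rewrite ler_wpM2r//; apply: ler_pM => //; rewrite ?mulr_ge0//.
  - by apply: ler_pM => //; rewrite mulr_ge0.
  - by rewrite ler_wpM2r.
have b2 : 2 ^+ k * l ^+ k <= (1 / 32) ^+ k.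
  by rewrite -exprMn lerXn2r ?nnegrE//; lra.
case: k lk k2 k20 a2 b2 => [|k] lk k2 k20 a2 b2.
  rewrite /= add0r; apply: le_trans a2 _.
  by rewrite !expr0 !mulr1.
rewrite /=.
have b3 : (1 / 32 : R) ^+ k.+1 <= 1 / 16 * (1 / 2) ^+ k.+1.
  rewrite (_ : 1 / 32 = 1 / 16 * (1 / 2) :> R); last by field.
  have h2 : (0 : R) <= (1 / 2) ^+ k.+1 by apply: exprn_ge0; lra.
  have h16 : (1 / 16 : R) ^+ k <= 1 by apply: exprn_ile1; lra.
  by rewrite exprMn; apply: ler_wpM2r => //; rewrite exprS; lra.
have a1 : pi * d * l ^+ k.+1 <= 4 * d * l ^+ k.+1.
  by rewrite ler_wpM2r// ler_wpM2r.
have a3 : l ^+ k.+1 <= 2^-1 * (2 ^+ k.+1 * l ^+ k.+1).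
  rewrite mulrA ler_peMl// exprS mulrA mulVf// mul1r.
  by rewrite exprn_ege1//; lra.
have q0 : 0 <= (1 / 2 : R) ^+ k.+1 by rewrite exprn_ge0//; lra.
set A := 2 ^+ k.+1 * l ^+ k.+1 in a2 b2 a3 *.
set q := (1 / 2) ^+ k.+1 in q0 b3 *.
have : d * l ^+ k.+1 <= d * (2^-1 * A) by rewrite ler_wpM2l.
have : d * A <= d * (1 / 16 * q) by rewrite ler_wpM2l//; exact: le_trans b2 b3.
have : 0 <= d * q by rewrite mulr_ge0.
lra.
Qed.

(** * Size and Lipschitz estimate of the remainder of the series *)

Section series_remainder.
Variables h H : R[i].
Local Notation C := (Psi_bound h H).

(* The [nu = k.+1] term of the series without [(pi - x) N x]. *)
Definition rest (N : R -> R[i]) (k : nat) (x : R) : R[i] :=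
  (if k == 0%N then 0 else psi k.+1 x * Vpow N k.+1 x) +
  Psi_int h H k.+1 (Vpow N k.+1) x.

Definition remainder (N : R -> R[i]) (x : R) : R[i] :=
  clim (fun n => \sum_(0 <= k < n) rest N k x).

Lemma sum_main_term N x n :
  \sum_(1 <= nu < n.+2) main_term h H N x nu =
  (pi - x)%:C * N x + \sum_(0 <= k < n.+1) rest N k x.
Proof.
rewrite big_add1 /= big_nat_recl// [in RHS]big_nat_recl// addrA; congr (_ + _).
rewrite /main_term /rest /= add0r; congr (_ * _ + _).
by rewrite /psi expr1; congr (_%:C); exact: divr1.
Qed.

Lemma Cmeas_rest N k : Cmeas I N -> Cmeas I (rest N k).
Proof.
move=> mN; apply: CmeasD; last exact/Cmeas_Psi_int/Cmeas_Vpow.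
case: eqP => _; first exact: Cmeas_cst.
apply: CmeasM; last exact: Cmeas_Vpow.
apply: Cmeas_real; apply: measurable_funM => //.
by apply: measurable_funX; exact: measurable_funB.
Qed.

Lemma expw_norm1_psi p k x (F : R -> R[i]) : I x ->
  expw p x * norm1 (psi k x * F x) = wnorm p k F x / k`!%:R.
Proof.
move=> /mem_itv0 xI; rewrite /psi norm1Zl ger0_norm /wnorm /expw; first by ring.
by rewrite divr_ge0// exprn_ge0//; lra.
Qed.

Lemma expw_gt0 p x : 0 < expw p x.
Proof. exact: expR_gt0. Qed.

Lemma expw_le1 p x : 0 <= p -> I x -> expw p x <= 1.
Proof.
by move=> p0 /mem_itv0 xI; rewrite -expR0 ler_expR oppr_le0 mulr_ge0//; lra.
Qed.

Section bound.
Variables (p l : R) (N : R -> R[i]).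
Hypotheses (p0 : 0 <= p) (l0 : 0 <= l) (mN : Cmeas I N) (sN : small p l N).

(** Here the exponential is bounded by 1 and the power of [N] is integrated. *)
Lemma rconv_expw_Vpow k x : I x ->
  (rconv (expw p) (wnorm p k.+1 (Vpow N k.+1)) x <= (pi * l ^+ k.+1)%:E)%E.
Proof.
move=> xI; have mw := measurable_wnorm p k.+1 (Cmeas_Vpow k.+1 mN).
have e0 t : I t -> 0 <= expw p t by move=> _; exact: expR_ge0.
have w0 t : I t -> 0 <= wnorm p k.+1 (Vpow N k.+1) t by exact: wnorm_ge0.
rewrite (rconvC (@measurable_expw p I) mw e0 w0 xI).
apply: le_trans (rconv_le mw (@measurable_expw p I) w0 e0 xI ler01 _) _.
  by apply: ae_all => t; exact: expw_le1.
by rewrite mul1e; exact: int_wnorm_Vpow.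
Qed.

Lemma rest_le k x : I x ->
  expw p x * norm1 (rest N k x) <= (1 + C * pi) * l ^+ k.+1.
Proof.
move=> xI; have e0 := ltW (expw_gt0 p x).
apply: le_trans (ler_wpM2l e0 (norm1D _ _)) _; rewrite mulrDr mulrDl.
apply: lerD.
  case: k => [|k] /=; first by rewrite norm10 mulr0 mul1r exprn_ge0.
  rewrite expw_norm1_psi// mul1r; apply: le_trans (wnorm_Vpow l0 mN sN k xI).
  (* The factorial is only bounded below by 1; the geometric decay comes from [l]. *)
  by rewrite ler_pdivrMr ?ltr0n ?fact_gt0// ler_peMr ?wnorm_ge0// ler1n fact_gt0.
rewrite -lee_fin; apply: le_trans (norm1_Psi_int h H k p xI (Cmeas_Vpow _ mN)) _.
rewrite -mulrA EFinM; apply: lee_wpmul2l; first by rewrite lee_fin Psi_bound_ge0.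
exact: rconv_expw_Vpow.
Qed.

Hypothesis l2 : l <= 1 / 2.

Lemma rest_geometric x n : I x ->
  norm1 (\sum_(0 <= k < n.+1) rest N k x - \sum_(0 <= k < n) rest N k x) <=
  ((1 + C * pi) * l / expw p x) * (1 / 2) ^+ n.
Proof.
move=> xI; rewrite big_nat_recr//= addrAC subrr add0r.
rewrite mulrAC ler_pdivlMr ?expw_gt0// mulrC; apply: le_trans (rest_le n xI) _.
rewrite -mulrA ler_wpM2l ?addr_ge0 ?mulr_ge0 ?Psi_bound_ge0 ?pi_ge0//.
by rewrite exprS ler_wpM2l// lerXn2r ?nnegrE//; lra.
Qed.

Lemma Cmeas_remainder : Cmeas I (remainder N).
Proof.
apply: (@Cmeas_clim _ _ I (fun x n => \sum_(0 <= k < n) rest N k x)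
  (fun x => (1 + C * pi) * l / expw p x)).
- by move=> n; apply: Cmeas_sum => k; exact: Cmeas_rest.
- by move=> x n xI; exact: rest_geometric.
Qed.

Lemma norm1_cvg_remainder x : I x ->
  norm1_cvg (fun n => \sum_(0 <= k < n) rest N k x) (remainder N x).
Proof. by move=> xI; apply: norm1_cvg_clim => n; exact: rest_geometric. Qed.

Lemma norm1_remainder x : I x ->
  expw p x * norm1 (remainder N x) <= 2 * (1 + C * pi) * l.
Proof.
move=> xI; have B0 : 0 <= (1 + C * pi) * l / expw p x.
  rewrite divr_ge0 ?(ltW (expw_gt0 _ _))// mulr_ge0//.
  by rewrite addr_ge0 ?mulr_ge0 ?Psi_bound_ge0 ?pi_ge0.
(* The partial sum of index 0 is empty, so the distance from it to the limit is the size of the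
   limit itself. *)
have := clim_geometric_le 0 B0 (fun n => rest_geometric n xI).
rewrite big_nil subr0 expr0 mulr1 => hle; rewrite mulrC -ler_pdivlMr ?expw_gt0//.
by apply: le_trans hle _; rewrite !mulrA.
Qed.

(** For small [N] the series converges at every point of [I], so the equation at [x] is an identity
    between numbers; existence and uniqueness both use it in this form. *)
Lemma main_term_cvgP x (a : R[i]) : I x ->
  ((fun n => \sum_(1 <= nu < n) main_term h H N x nu : R[i]^o) @ \oo
    --> (a : R[i]^o)) <-> a = (pi - x)%:C * N x + remainder N x.
Proof.
move=> xI.
have hc : norm1_cvg (fun n => \sum_(1 <= nu < n) main_term h H N x nu)
    ((pi - x)%:C * N x + remainder N x).
  have hr := norm1_cvg_remainder xI.
  have : (fun n => norm1 (\sum_(0 <= k < n.+1) rest N k x - remainder N x))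
      @ \oo --> 0.
    by rewrite (cvg_shiftS (fun n => norm1 (\sum_(0 <= k < n) rest N k x - _))).
  move=> h1; rewrite /norm1_cvg.
  (* One shift for nu = k + 1, and one so that the term nu = 1, from which (pi - x) N is split off,
     is present. *)
  rewrite -(cvg_shiftn 2 (fun n =>
    norm1 (\sum_(1 <= nu < n) main_term h H N x nu - _))).
  apply: cvg_trans h1; apply: near_eq_cvg.
  apply: nearW => n /=; rewrite addn2 sum_main_term opprD addrACA subrr add0r.
  by [].
split; first by move=> /norm1_cvgP h1; exact: norm1_cvg_unique h1 hc.
by move=> ->; exact/norm1_cvgP.
Qed.

End bound.

Lemma restB N N' k x : rest N k x - rest N' k x =
  (if k == 0%N then 0 else psi k.+1 x * (Vpow N k.+1 x - Vpow N' k.+1 x)) +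
  (Psi_int h H k.+1 (Vpow N k.+1) x - Psi_int h H k.+1 (Vpow N' k.+1) x).
Proof.
rewrite /rest; move: (Psi_int _ _ _ _ _) (Psi_int _ _ _ _ _) => a b.
move: (psi _ _) (Vpow N _ _) (Vpow N' _ _) => s u v.
by rewrite opprD addrACA; case: eqP => _; rewrite ?subrr// mulrBr.
Qed.

Section lipschitz.
Variables (p l d e : R) (N N' : R -> R[i]).
Hypotheses (p0 : 0 <= p) (l0 : 0 <= l) (l64 : l <= 1 / 64) (d0 : 0 <= d).
Hypotheses (mN : Cmeas I N) (sN : small p l N).
Hypotheses (mN' : Cmeas I N') (sN' : small p l N').
Hypothesis he : (\int[mu]_(t in I) (expw p t)%:E <= e%:E)%E.
Hypotheses (e0 : 0 <= e) (Ce : C * e <= 1 / 16).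
Hypothesis NN' :
  {ae mu, forall x, I x -> wnorm p 1 (fun y => N y - N' y) x <= d}.

(** In the [psi] part, nu! absorbs the factor nu from the difference of nu-th powers. In the
    integral part the roles in [rconv_expw_Vpow] are exchanged: the difference carries the sup bound
    and the exponential its L1 norm [e], the only small factor besides [d] when k = 0. *)
Lemma restB_le k x : I x ->
  expw p x * norm1 (rest N k x - rest N' k x) <=
  (if k == 0%N then 0 else pi * d * l ^+ k) +
  C * (pi * d * k.+1%:R * l ^+ k * e).
Proof.
move=> xI; have ew0 := ltW (expw_gt0 p x).
rewrite restB; apply: le_trans (ler_wpM2l ew0 (norm1D _ _)) _; rewrite mulrDr.
apply: lerD.
  case: k => [|k] /=; first by rewrite norm10 mulr0.
  rewrite (expw_norm1_psi p k.+2 (fun y => Vpow N k.+2 y - Vpow N' k.+2 y))//.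
  rewrite ler_pdivrMr ?ltr0n ?fact_gt0//.
  apply: le_trans (wnorm_VpowB l0 d0 mN sN mN' sN' NN' k xI) _.
  rewrite mulrAC ler_wpM2l ?mulr_ge0 ?pi_ge0 ?exprn_ge0//.
  by rewrite ler_nat; exact: fact_geq.
have mB : Cmeas I (fun y => Vpow N k.+1 y - Vpow N' k.+1 y).
  exact: Cmeas_VpowB.
have mw := measurable_wnorm p k.+1 mB.
have ex0 t : I t -> 0 <= expw p t by move=> _; exact: expR_ge0.
have w0 t : I t -> 0 <= wnorm p k.+1 (fun y => Vpow N k.+1 y - Vpow N' k.+1 y) t.
  exact: wnorm_ge0.
rewrite -lee_fin; apply: le_trans (norm1_Psi_intB h H xI (Cmeas_Vpow _ mN)
  (Cmeas_Vpow _ mN') _ _) _.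
- by apply: le_lt_trans (rconv_expw_Vpow p0 l0 mN sN k xI) (ltry _).
- by apply: le_lt_trans (rconv_expw_Vpow p0 l0 mN' sN' k xI) (ltry _).
rewrite EFinM; apply: lee_wpmul2l; first by rewrite lee_fin Psi_bound_ge0.
have c0 : 0 <= pi * d * k.+1%:R * l ^+ k by rewrite !mulr_ge0 ?pi_ge0 ?exprn_ge0.
apply: le_trans (rconv_le (@measurable_expw p I) mw ex0 w0 xI c0 _) _.
  exact: ae_wnorm_VpowB.
by rewrite [leRHS]EFinM; apply: lee_wpmul2l.
Qed.

Lemma restB_geometric k x : I x ->
  expw p x * norm1 (rest N k x - rest N' k x) <= d / 4 * (1 / 2) ^+ k.
Proof.
move=> xI; apply: le_trans (restB_le k xI) _.
by apply: lipschitz_coef_le => //; exact: Psi_bound_ge0.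
Qed.

(** The bounds d / 4 times 2^(-k) sum to d / 2, whence the contraction factor 1/2. *)
Lemma remainder_lipschitz x : I x ->
  expw p x * norm1 (remainder N x - remainder N' x) <= d / 2.
Proof.
move=> xI; have l2 := le_half l64.
rewrite mulrC -ler_pdivlMr ?expw_gt0//.
have c := norm1_cvgB (norm1_cvg_remainder p0 l0 mN sN l2 xI)
                     (norm1_cvg_remainder p0 l0 mN' sN' l2 xI).
apply: norm1_cvg_le c _; apply: nearW => n.
rewrite -sumrB ler_pdivlMr ?expw_gt0// mulrC.
apply: le_trans (ler_wpM2l (ltW (expw_gt0 p x)) (norm1_sum _ _)) _.
rewrite mulr_sumr; apply: (@le_trans _ _ (d / 2 * (1 - (1 / 2) ^+ n))).
  elim: n => [|n ih]; first by rewrite big_nil expr0 subrr mulr0.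
  rewrite big_nat_recr//= exprS.
  apply: le_trans (lerD ih (restB_geometric n xI)) _.
  by rewrite le_eqVlt; apply/orP; left; apply/eqP; field.
rewrite ler_piMr//; first by rewrite divr_ge0.
Qed.

End lipschitz.

End series_remainder.

(** * Existence and uniqueness *)

(** Dominated convergence along integers p = n: the integrand tends to 0 at each t > 0 and is
    dominated by [g]. *)
Lemma int_expw_small (g : R -> R) (e : R) : measurable_fun I g ->
  (forall x, I x -> 0 <= g x) -> (\int[mu]_(t in I) (g t)%:E < +oo)%E -> 0 < e ->
  exists2 p, 0 <= p & (\int[mu]_(t in I) (g t * expw p t)%:E <= e%:E)%E.
Proof.
move=> mg g0 ig e0.
pose f n t := (g t * expw n%:R t)%:E.
have mf n : measurable_fun I (f n).
  by apply/measurable_EFinP/measurable_funM => //; exact: measurable_expw.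
have intg : mu.-integrable I (EFin \o g).
  apply/integrableP; split; first exact/measurable_EFinP.
  rewrite (_ : (\int[mu]_(x in I) _)%E = (\int[mu]_(x in I) (g x)%:E)%E)//.
  by apply: eq_integral => t /set_mem tI; rewrite /= ger0_norm// g0.
have cf t : I t -> f ^~ t @ \oo --> (cst 0%E : R -> \bar R) t.
  move=> /[dup] /mem_itv0 tI It; apply: cvg_EFin.
    by apply: nearW => n; rewrite fin_numE.
  rewrite (_ : fine \o _ = fun n => g t * expR (- t) ^+ n); last first.
    by apply/funext => n; rewrite /= /expw -mulrN expRM_natl.
  rewrite -[X in _ --> X](mulr0 (g t)); apply: cvgM; first exact: cvg_cst.
  apply: cvg_expr; rewrite ger0_norm ?expR_ge0//.
  by rewrite -expR0 ltr_expR; lra.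
have fg t n : I t -> (`|f n t| <= (g t)%:E)%E.
  move=> It; rewrite /f /= lee_fin ger0_norm ?mulr_ge0 ?expR_ge0 ?g0//.
  by rewrite ler_piMr ?g0// expw_le1.
have [_ _] := @dominated_convergence _ _ _ mu I (measurable_itv _) f
  (cst 0%E) (EFin \o g) mf (measurable_cst 0%E) (ae_all cf) intg (ae_all fg).
rewrite integral0 => /fine_cvgP[fin /cvgrPdist_lt/(_ _ e0) h].
have [n [hn fn]] : exists n, `|0 - fine (\int[mu]_(t in I) f n t)%E| < e /\
    (\int[mu]_(t in I) f n t)%E \is a fin_num.
  by have [n _ hn] := filterI h fin; exists n; exact: (hn n (leqnn n)).
exists n%:R => //; rewrite -(fineK fn) lee_fin ltW//.
by apply: le_lt_trans hn; rewrite sub0r normrN ler_norm.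
Qed.

(* Dominates [1], [norm1 F] and [norm1 F ^+ 2], so that a single large [p] makes
   the weighted integrals of all three small. *)
Definition majorant (F : R -> R[i]) (x : R) : R :=
  1 + norm1 (F x) + norm1 (F x) ^+ 2.

Lemma measurable_majorant F : Cmeas I F -> measurable_fun I (majorant F).
Proof.
move=> /Cmeas_norm1 mF; apply: measurable_funD; last exact: measurable_funX.
exact: measurable_funD.
Qed.

Lemma majorant_ge0 F x : 0 <= majorant F x.
Proof. by rewrite !addr_ge0 ?norm1_ge0 ?exprn_ge0 ?norm1_ge0. Qed.

Lemma integral_cst_I (b : R) : (\int[mu]_(t in I) b%:E = (b * pi)%:E)%E.
Proof.
rewrite (integral_cst mu (measurable_itv _)) EFinM; congr (_ * _)%E.
rewrite [LHS]lebesgue_measure_itv/= lte_fin (lt_le_trans ltr01 pi_ge1).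
by rewrite -EFinB subr0.
Qed.

Lemma measurable_normc_sqr D (F : R -> R[i]) : Cmeas D F ->
  measurable_fun D (fun x => ComplexField.Normc.normc (F x) ^+ 2).
Proof.
move=> [mFr mFi].
rewrite (_ : (fun _ => _) =
    (fun x => complex.Re (F x) ^+ 2 + complex.Im (F x) ^+ 2)); last first.
  apply/funext => x; case: (F x) => a b /=.
  by rewrite sqr_sqrtr// addr_ge0 ?sqr_ge0.
by apply: measurable_funD; exact: measurable_funX.
Qed.

Lemma L2_majorant (F : R -> R[i]) : L2 `]0, pi[ F ->
  Cmeas I F /\ (\int[mu]_(t in I) (majorant F t)%:E < +oo)%E.
Proof.
move=> [mFr mFi iF]; have mF : Cmeas I F by split.
split=> //.
have mn := measurable_normc_sqr mF.
apply: (@le_lt_trans _ _ (\int[mu]_(t in I) (2%:E +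
    4%:E * (ComplexField.Normc.normc (F t) ^+ 2)%:E))%E).
  apply: ge0_le_integral => //.
  - by move=> t _; rewrite lee_fin majorant_ge0.
  - by apply/measurable_EFinP; exact: measurable_majorant.
  - by apply: emeasurable_funD => //; apply: measurable_funeM; exact/measurable_EFinP.
  (* 1 + a + a^2 <= 2 + 2 a^2, and a^2 is at most twice the squared modulus. *)
  - move=> t _; rewrite -EFinM -EFinD lee_fin /majorant.
    move: (norm1_sqr_le (F t)).
    move: (norm1 (F t)) (ComplexField.Normc.normc (F t) ^+ 2) => a b ab.
    by have := sqr_ge0 a; have := sqr_ge0 (a - 1); rewrite sqrrB1; lra.
rewrite ge0_integralD//; last 2 first.
- by move=> t _; rewrite -EFinM lee_fin mulr_ge0// sqr_ge0.
- by apply: measurable_funeM; exact/measurable_EFinP.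
rewrite ge0_integralZl_EFin//; last 2 first.
- by move=> t _; rewrite lee_fin sqr_ge0.
- exact/measurable_EFinP.
rewrite integral_cst_I.
move: iF; case: (\int[mu]_(x in _) _)%E => //= [r _|_].
  by rewrite -EFinM -EFinD ltry.
by rewrite gt0_muleNy ?lte_fin.
Qed.

(** The weighted [N] is at most e^{-pt} |f| + r. Integration over [I], of length at most 4, and (a +
    b)^2 <= 2 a^2 + 2 b^2 give the two numerical conditions. With r = 0 this also covers f = (pi -
    t) N. *)
Lemma small_majorant p l e r (f N : R -> R[i]) : 0 <= p -> 0 <= e -> 0 <= r ->
  Cmeas I f -> Cmeas I N ->
  (\int[mu]_(t in I) (majorant f t * expw p t)%:E <= e%:E)%E ->
  (forall t, I t -> expw p t * norm1 ((pi - t)%:C * N t - f t) <= r) ->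
  e + 4 * r <= l -> 2 * e + 8 * r ^+ 2 <= l ^+ 2 -> small p l N.
Proof.
move=> p0 e0 r0 mf mN ie hr el el2.
have wle t : I t -> wnorm p 1 N t <= expw p t * norm1 (f t) + r.
  move=> It; have /mem_itv0 tI := It; apply: le_trans (lerD (lexx _) (hr t It)).
  rewrite -mulrDr /wnorm expr1 -/(expw p t) (mulrC (pi - t)) -mulrA.
  apply: ler_wpM2l; first exact/ltW/expw_gt0.
  rewrite -[X in X * _]ger0_norm; last by lra.
  rewrite -norm1Zl; apply: le_trans (norm1D _ _).
  by rewrite le_eqVlt; apply/orP; left; apply/eqP; congr norm1; ring.
have mh : measurable_fun I (fun t => majorant f t * expw p t).
  by apply: measurable_funM; [exact: measurable_majorant|exact: measurable_expw].
have m0 t : 0 <= majorant f t * expw p t.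
  by rewrite mulr_ge0 ?majorant_ge0 ?expR_ge0.
have mw := measurable_wnorm p 1 mN.
have key (a b c : R) (g : R -> R) : 0 <= a -> 0 <= b -> a * e + 4 * b <= c ->
    measurable_fun I g -> (forall t, I t -> 0 <= g t) ->
    (forall t, I t -> g t <= a * (majorant f t * expw p t) + b) ->
    (\int[mu]_(t in I) (g t)%:E <= c%:E)%E.
  move=> a0 b0 abc mg g0 gab.
  apply: (@le_trans _ _ (\int[mu]_(t in I) (a%:E *
      (majorant f t * expw p t)%:E + b%:E))%E).
    apply: ge0_le_integral => //.
    - exact/measurable_EFinP.
    - by apply: emeasurable_funD => //; apply: measurable_funeM; exact/measurable_EFinP.
  rewrite ge0_integralD//; last 2 first.
  - by move=> t _; rewrite -EFinM lee_fin mulr_ge0.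
  - by apply: measurable_funeM; exact/measurable_EFinP.
  rewrite ge0_integralZl_EFin//; last 2 first.
  - by move=> t _; rewrite lee_fin.
  - exact/measurable_EFinP.
  rewrite integral_cst_I.
  apply: le_trans (_ : (a * e + 4 * b)%:E <= _)%E; last by rewrite lee_fin.
  rewrite EFinD; apply: leeD.
    by rewrite EFinM; apply: lee_wpmul2l.
  by rewrite lee_fin mulrC ler_wpM2r// pi_le4.
have fm t : I t -> expw p t * norm1 (f t) <= majorant f t * expw p t.
  move=> It; rewrite mulrC ler_wpM2r ?expR_ge0// /majorant.
  by have := sqr_ge0 (norm1 (f t)); have := norm1_ge0 (f t); lra.
split.
- apply: (key 1 r) => //; first by rewrite mul1r.
  + by move=> t; exact: wnorm_ge0.
  + move=> t It; apply: le_trans (wle t It) _.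
    by rewrite mul1r lerD2r fm.
- apply: (key 2 (2 * r ^+ 2)) => //.
  + by rewrite mulr_ge0// sqr_ge0.
  + by lra.
  + exact: measurable_funX.
  + by move=> t _; rewrite sqr_ge0.
  move=> t It; have := wle t It; have w0 := wnorm_ge0 p 1 N It.
  have e1 := expw_le1 p0 It; have ep := expw_gt0 p t.
  have n0 := norm1_ge0 (f t).
  (* One of the two exponentials is bounded by 1, since the integral of [majorant] carries only
     one. *)
  have h1 : (expw p t * norm1 (f t)) ^+ 2 <= majorant f t * expw p t.
    rewrite exprMn expr2 -mulrA mulrC ler_wpM2r ?(ltW ep)//.
    apply: (@le_trans _ _ (norm1 (f t) ^+ 2)).
      by rewrite ler_piMl// ?sqr_ge0.
    by rewrite /majorant lerDr addr_ge0.
  move=> h2; have h3 : wnorm p 1 N t ^+ 2 <= (expw p t * norm1 (f t) + r) ^+ 2.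
    by rewrite lerXn2r ?nnegrE// addr_ge0// mulr_ge0// (ltW ep).
  have := sqr_ge0 (expw p t * norm1 (f t) - r).
  rewrite sqrrB; rewrite sqrrD in h3; lra.
Qed.

(** On [I] the exponential is at least e^{-p pi}, so removing it from the square costs the constant
    [k]. *)
Lemma small_L2 p l (N : R -> R[i]) : 0 <= p -> Cmeas I N -> small p l N ->
  L2 `]0, pi[ (fun x => (pi - x)%:C * N x).
Proof.
move=> p0 mN sN.
have mM : Cmeas I (fun x => (pi - x)%:C * N x).
  by apply: CmeasM => //; apply: Cmeas_real; exact: measurable_funB.
have [mMr mMi] := mM; split => //.
have mn := measurable_normc_sqr mM.
have mw2 : measurable_fun I (fun t => wnorm p 1 N t ^+ 2).
  by apply: measurable_funX; exact: measurable_wnorm.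
pose k := expR (p * pi) ^+ 2.
apply: (@le_lt_trans _ _ (\int[mu]_(t in I) (k%:E * (wnorm p 1 N t ^+ 2)%:E))%E).
  apply: ge0_le_integral => //.
  - by move=> t _; rewrite lee_fin sqr_ge0.
  - exact/measurable_EFinP.
  - by apply: measurable_funeM; exact/measurable_EFinP.
  move=> t It; have /mem_itv0 tI := It; rewrite -EFinM lee_fin.
  apply: le_trans (normc_sqr_le _) _; rewrite norm1Zl ger0_norm; last by lra.
  rewrite /k -exprMn lerXn2r ?nnegrE//.
  - by rewrite mulr_ge0 ?norm1_ge0//; lra.
  - by rewrite mulr_ge0 ?expR_ge0 ?wnorm_ge0.
  have e1 : 1 <= expR (p * pi) * expR (- (p * t)).
    by rewrite -expRD -expR0 ler_expR subr_ge0 ler_wpM2l//; lra.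
  rewrite [leRHS](_ : _ = (expR (p * pi) * expR (- (p * t))) *
    ((pi - t) * norm1 (N t))); last by rewrite /wnorm; ring.
  by rewrite ler_peMl// mulr_ge0 ?norm1_ge0//; lra.
rewrite ge0_integralZl_EFin//; last 3 first.
- by move=> t _; rewrite lee_fin sqr_ge0.
- exact/measurable_EFinP.
- by rewrite exprn_ge0// expR_ge0.
apply: (@le_lt_trans _ _ (k%:E * (l ^+ 2)%:E)%E); last by rewrite -EFinM ltry.
by apply: lee_wpmul2l; [rewrite lee_fin exprn_ge0// expR_ge0|exact: sN.2].
Qed.

Lemma Cmeas_pi_inv : Cmeas I (fun x : R => ((pi - x)^-1)%:C).
Proof.
apply: Cmeas_real.
apply: (@eq_measurable_fun _ _ _ _ _ (fun x : R => (pi - x) `^ (-1))).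
  by move=> x /set_mem/mem_itv0 xI; rewrite powR_inv1//; lra.
have mB : measurable_fun I (fun x : R => pi - x) by exact: measurable_funB.
exact: (measurableT_comp (@measurable_powR R (-1)) mB).
Qed.

Lemma int_expw_le_majorant p e (f : R -> R[i]) : Cmeas I f ->
  (\int[mu]_(t in I) (majorant f t * expw p t)%:E <= e%:E)%E ->
  (\int[mu]_(t in I) (expw p t)%:E <= e%:E)%E.
Proof.
move=> mf; apply: le_trans; apply: ge0_le_integral => //.
- by move=> t _; rewrite lee_fin expR_ge0.
- by apply/measurable_EFinP; exact: measurable_expw.
- apply/measurable_EFinP; apply: measurable_funM; last exact: measurable_expw.
  exact: measurable_majorant.
- move=> t _; rewrite lee_fin ler_peMl ?expR_ge0// /majorant -addrA lerDl.
  by rewrite addr_ge0 ?exprn_ge0 ?norm1_ge0.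
Qed.

(** * Picard iteration in a weighted ball *)

Section existence.
Variables (h H : R[i]) (f : R -> R[i]) (p l e r : R).
Local Notation C := (Psi_bound h H).
Hypotheses (p0 : 0 <= p) (l0 : 0 <= l) (e0 : 0 <= e) (r0 : 0 <= r).
Hypotheses (mf : Cmeas I f).
Hypothesis ef : (\int[mu]_(t in I) (majorant f t * expw p t)%:E <= e%:E)%E.
Hypotheses (el : e <= l) (el2 : 2 * e <= l ^+ 2) (Ce : C * e <= 1 / 16).
Hypotheses (rl : 2 * (1 + C * pi) * l <= r / 2) (l64 : l <= 1 / 64).
Hypotheses (er : e + 4 * r <= 1 / 64) (er2 : 2 * e + 8 * r ^+ 2 <= (1 / 64) ^+ 2).

(** Inverts u = (pi - x) N - f: the iteration runs on the bounded unknown [u], from which [N] is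
    recovered. *)
Definition quot (u : R -> R[i]) (x : R) : R[i] := ((pi - x)^-1)%:C * (f x + u x).

Definition picard (u : R -> R[i]) (x : R) : R[i] := - remainder h H (quot u) x.

(** The ball of radius [r] for the weighted sup norm; [r] is such that [quot u] stays 1/64-small on
    it. *)
Definition picard_dom (u : R -> R[i]) :=
  Cmeas I u /\ forall x, I x -> expw p x * norm1 (u x) <= r.

Lemma pi_quot u x : I x -> (pi - x)%:C * quot u x = f x + u x.
Proof.
move=> /mem_itv0 xI; rewrite mulrA -rmorphM/= divff ?mul1r//.
by apply: lt0r_neq0; lra.
Qed.

Lemma Cmeas_quot u : Cmeas I u -> Cmeas I (quot u).
Proof.
move=> mU; apply: CmeasM; last exact: CmeasD.
exact: Cmeas_pi_inv.
Qed.

Lemma wnorm_quotB u v x : I x ->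
  wnorm p 1 (fun y => quot u y - quot v y) x = expw p x * norm1 (u x - v x).
Proof.
move=> xI; have /mem_itv0 x0 := xI.
rewrite /wnorm expr1 -/(expw p x) (mulrC (pi - x)) -mulrA; congr (_ * _).
rewrite -[X in X * _]ger0_norm; last by lra.
by rewrite -norm1Zl mulrBr !pi_quot// addrAC opprD addrA subrr add0r addrC.
Qed.

Lemma small_quot u : picard_dom u -> small p (1 / 64) (quot u).
Proof.
move=> [mu_ ub]; apply: (small_majorant p0 e0 r0 mf (Cmeas_quot mu_) ef) => //.
by move=> t It; rewrite pi_quot// addrAC subrr add0r ub.
Qed.

(** At u = 0 no error [r] enters, so the threshold [l] is reached; it is what bounds [picard] at 0
    by r / 2. *)
Lemma small_quot0 : small p l (quot (fun=> 0)).
Proof.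
apply: (small_majorant p0 e0 (lexx 0) mf (Cmeas_quot (Cmeas_cst _ _)) ef) => //.
- by move=> t It; rewrite pi_quot// addr0 subrr norm10 mulr0.
- by rewrite mulr0 addr0.
- by rewrite expr0n mulr0 addr0.
Qed.

Lemma picard_dom0 : picard_dom (fun=> 0).
Proof.
by split; [exact: Cmeas_cst|move=> x _; rewrite norm10 mulr0].
Qed.

Lemma picard_lipschitz u v d : picard_dom u -> picard_dom v -> 0 <= d ->
  (forall x, I x -> expw p x * norm1 (u x - v x) <= d) ->
  forall x, I x -> expw p x * norm1 (picard u x - picard v x) <= d / 2.
Proof.
move=> Du Dv d0 uv x xI; rewrite /picard -opprD norm1N.
have l1 : (0 : R) <= 1 / 64 by lra.
apply: (remainder_lipschitz p0 l1 (lexx _) d0 (Cmeas_quot Du.1) (small_quot Du)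
  (Cmeas_quot Dv.1) (small_quot Dv)
  (int_expw_le_majorant mf ef) e0 Ce _ xI).
by apply: ae_all => y yI; rewrite wnorm_quotB// uv.
Qed.

(** Half of the radius pays for the distance between the images of [u] and 0, the other half for the
    image of 0. *)
Lemma picard_domP u : picard_dom u -> picard_dom (picard u).
Proof.
move=> Du; have l1 : (0 : R) <= 1 / 64 by lra.
have l2 : (1 / 64 : R) <= 1 / 2 by lra.
split.
  apply: CmeasN.
  exact: (Cmeas_remainder h H p0 l1 (Cmeas_quot Du.1) (small_quot Du) l2).
move=> x xI.
have h1 : expw p x * norm1 (picard u x - picard (fun=> 0) x) <= r / 2.
  apply: (picard_lipschitz Du picard_dom0 r0 _ xI) => y yI.
  by rewrite subr0; exact: Du.2.
have h2 : expw p x * norm1 (picard (fun=> 0) x) <= r / 2.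
  rewrite norm1N; apply: le_trans rl.
  apply: (norm1_remainder h H p0 l0 (Cmeas_quot (Cmeas_cst _ _)) small_quot0 _ xI).
  exact: le_half.
rewrite (_ : picard u x = (picard u x - picard (fun=> 0) x) + picard (fun=> 0) x);
  last by rewrite subrK.
apply: le_trans (ler_wpM2l (ltW (expw_gt0 p x)) (norm1D _ _)) _.
by rewrite mulrDr; lra.
Qed.

Let u_ n := iter n picard (fun=> 0).

Lemma picard_dom_iter n : picard_dom (u_ n).
Proof.
by elim: n => [|n ih]; [exact: picard_dom0|exact: picard_domP].
Qed.

Lemma picard_increment n x : I x ->
  expw p x * norm1 (u_ n.+1 x - u_ n x) <= r * (1 / 2) ^+ n.
Proof.
elim: n x => [|n ih] x xI.
  by rewrite /u_ /= subr0 expr0 mulr1; have [_] := picard_dom_iter 1; apply.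
rewrite [leRHS](_ : _ = r * (1 / 2) ^+ n / 2); last by rewrite exprS; field.
apply: (picard_lipschitz (picard_dom_iter n.+1) (picard_dom_iter n)) => //.
by rewrite mulr_ge0// exprn_ge0//; lra.
Qed.

Lemma picard_geometric x : I x -> forall n,
  norm1 (u_ n.+1 x - u_ n x) <= (r / expw p x) * (1 / 2) ^+ n.
Proof.
move=> xI n; rewrite mulrAC ler_pdivlMr ?expw_gt0// mulrC.
exact: picard_increment.
Qed.

Let u x := clim (fun n => u_ n x).

Lemma picard_tail n x : I x ->
  expw p x * norm1 (u x - u_ n x) <= 2 * r * (1 / 2) ^+ n.
Proof.
move=> xI; have B0 : 0 <= r / expw p x by rewrite divr_ge0// (ltW (expw_gt0 _ _)).
have := clim_geometric_le n B0 (picard_geometric xI).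
rewrite mulrA mulrAC ler_pdivlMr ?expw_gt0//.
by rewrite mulrC.
Qed.

Lemma picard_dom_lim : picard_dom u.
Proof.
split.
  apply: (@Cmeas_clim _ _ I (fun x n => u_ n x) (fun x => r / expw p x)).
    by move=> n; have [] := picard_dom_iter n.
  by move=> x n xI; exact: picard_geometric.
move=> x xI; rewrite mulrC -ler_pdivlMr ?expw_gt0//.
apply: norm1_cvg_le (norm1_cvg_clim (picard_geometric xI)) _.
apply: nearW => n; rewrite ler_pdivlMr ?expw_gt0// mulrC.
by have [_] := picard_dom_iter n; apply.
Qed.

Lemma picard_fixpoint : exists2 v, picard_dom v &
  forall x, I x -> picard v x = v x.
Proof.
exists u; first exact: picard_dom_lim.
move=> x xI; apply/eqP; rewrite -subr_eq0; apply/eqP/norm1_eq0.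
(* The weighted distances from [picard u] and from [u] to the iterate of index n + 1 are both at
   most r 2^(-n). *)
have h1 n : expw p x * norm1 (picard u x - u x) <= 2 * r * (1 / 2) ^+ n.
  have a : expw p x * norm1 (picard u x - u_ n.+1 x) <= 2 * r * (1 / 2) ^+ n / 2.
    apply: (picard_lipschitz picard_dom_lim (picard_dom_iter n)) => //.
      by rewrite !mulr_ge0// exprn_ge0//; lra.
    by move=> y yI; exact: picard_tail.
  have b := picard_tail n.+1 xI.
  rewrite (_ : picard u x - u x =
    (picard u x - u_ n.+1 x) - (u x - u_ n.+1 x)); last first.
    by rewrite opprB addrA subrK.
  apply: le_trans (ler_wpM2l (ltW (expw_gt0 p x)) (norm1B _ _)) _.
  by rewrite mulrDr; move: a b; rewrite exprS; lra.
have : expw p x * norm1 (picard u x - u x) <= 0.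
  have cv : (fun n => 2 * r * (1 / 2) ^+ n) @ \oo --> 0.
    rewrite -[X in _ --> X](mulr0 (2 * r)); apply: cvgM; first exact: cvg_cst.
    by apply: cvg_expr; rewrite ger0_norm; lra.
  by apply: (cvgr_to_ge cv); apply: nearW.
by rewrite pmulr_rle0// expw_gt0.
Qed.

End existence.

(** * Uniqueness among small solutions *)

Section uniqueness.
Variables (h H : R[i]) (f N N' : R -> R[i]) (p l e : R).
Local Notation C := (Psi_bound h H).
Hypotheses (p0 : 0 <= p) (l0 : 0 <= l) (l64 : l <= 1 / 64) (e0 : 0 <= e).
Hypotheses (mN : Cmeas I N) (sN : small p l N).
Hypotheses (mN' : Cmeas I N') (sN' : small p l N').
Hypothesis he : (\int[mu]_(t in I) (expw p t)%:E <= e%:E)%E.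
Hypothesis Ce : C * e <= 1 / 16.
Hypothesis eqN : main_equation h H f N.
Hypothesis eqN' : main_equation h H f N'.

Lemma wnorm_sub : {ae mu, forall x, I x ->
  wnorm p 1 (fun y => N y - N' y) x =
  expw p x * norm1 (remainder h H N x - remainder h H N' x)}.
Proof.
have l2 := le_half l64.
apply: ae_impl2 eqN eqN' => x xN xN' xI; have /mem_itv0 x0 := xI.
have := (main_term_cvgP h H p0 l0 mN sN l2 (f x) xI).1 (xN xI).
rewrite ((main_term_cvgP h H p0 l0 mN' sN' l2 (f x) xI).1 (xN' xI)) => E.
rewrite /wnorm expr1 -/(expw p x) (mulrC (pi - x)) -mulrA; congr (_ * _).
rewrite -[X in X * _]ger0_norm; last by lra.
rewrite -norm1Zl -[LHS]norm1N; congr norm1.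
move: E; set a := _ * N' x; set b := _ * N x => E.
rewrite mulrBr opprB -/a -/b.
by apply/eqP; rewrite subr_eq addrAC eq_sym subr_eq addrC E addrC.
Qed.

(** The sup bounds on the two remainders provide a finite [d] to start from, each contraction halves
    it, and the countably many exceptional null sets are merged before n tends to infinity. *)
Lemma main_equation_unique : {ae mu, forall x, I x -> N' x = N x}.
Proof.
have l2 := le_half l64; have C0 := Psi_bound_ge0 h H.
pose d := 2 * (1 + C * pi) * l + 2 * (1 + C * pi) * l.
have d0 : 0 <= d.
  by rewrite addr_ge0// !mulr_ge0// addr_ge0// mulr_ge0// pi_ge0.
have bd n : {ae mu, forall x, I x ->
    wnorm p 1 (fun y => N y - N' y) x <= d * (1 / 2) ^+ n}.
  elim: n => [|n ih]; apply: ae_impl wnorm_sub => x E xI; rewrite E//.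
    rewrite expr0 mulr1.
    apply: le_trans (ler_wpM2l (ltW (expw_gt0 p x)) (norm1B _ _)) _.
    by rewrite mulrDr; apply: lerD; exact: (norm1_remainder h H p0 l0 _ _ l2 xI).
  rewrite [leRHS](_ : _ = d * (1 / 2) ^+ n / 2); last by rewrite exprS; field.
  apply: (remainder_lipschitz p0 l0 l64 _ mN sN mN' sN' he e0 Ce ih xI).
  by rewrite mulr_ge0// exprn_ge0//; lra.
have /ae_foralln := bd.
apply: ae_impl => x xd xI; have /mem_itv0 x0 := xI.
have : wnorm p 1 (fun y => N y - N' y) x <= 0.
  have cv : (fun n => d * (1 / 2) ^+ n) @ \oo --> 0.
    rewrite -[X in _ --> X](mulr0 d); apply: cvgM; first exact: cvg_cst.
    by apply: cvg_expr; rewrite ger0_norm; lra.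
  by apply: (cvgr_to_ge cv); apply: nearW => n; exact: xd.
rewrite /wnorm pmulr_rle0; last by rewrite mulr_gt0 ?expR_gt0// expr1; lra.
by move=> /norm1_eq0/eqP; rewrite subr_eq0 => /eqP ->.
Qed.

End uniqueness.


(** * Choice of the constants for arbitrary data *)

Lemma main_equation_exists (h H : R[i]) (f : R -> R[i]) : L2 `]0, pi[ f ->
  exists N p, [/\ 0 <= p, Cmeas I N, small p (1 / 64) N & main_equation h H f N].
Proof.
move=> /L2_majorant[mf intf].
have C0 := Psi_bound_ge0 h H; have pi1 := pi_ge1.
set C := Psi_bound h H in C0.
have Cpi : 0 <= C * pi by rewrite mulr_ge0// pi_ge0.
have K0 : 0 < 4 * (1 + C * pi) by lra.
(* The factor 8 leaves room for both e + 4 r <= 1/64 and 2 e + 8 r^2 <= (1/64)^2. *)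
have [r r0 r64] : exists2 r : R, 0 < r & 1 / 64 = 8 * r.
  by exists (1 / 512); lra.
(* These values turn 2 (1 + C pi) l <= r / 2 and 2 e <= l^2 into equalities. They depend on [h] and
   [H] only; [p] is chosen afterwards from [f] and [e]. *)
pose l := r / (4 * (1 + C * pi)); pose e := l ^+ 2 / 2.
have Kl : 4 * l + 4 * (C * pi * l) = r.
  rewrite -[RHS](divfK (lt0r_neq0 K0)) -/l; ring.
have l0 : 0 < l by rewrite divr_gt0.
have e0 : 0 < e by rewrite divr_gt0// exprn_gt0.
have Cl0 : 0 <= C * l by rewrite mulr_ge0// ltW.
have Cpl : C * l <= C * pi * l by rewrite mulrAC ler_peMr.
have lr : l <= r / 4 by lra.
have Clr : C * l <= r / 4 by lra.
have ll : l * l <= r / 4 * (r / 4) by apply: ler_pM => //; exact: ltW.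
have r1 : r <= 1 by lra.
have l2 : l * l <= 1 * l by apply: ler_wpM2r; [exact: ltW|lra].
have el : e <= l by rewrite /e expr2; lra.
have Ce : C * e <= 1 / 16.
  rewrite (_ : C * e = C * l * l / 2); last by rewrite /e; field.
  have : C * l * l <= 1 * l by apply: ler_wpM2r; [exact: ltW|lra].
  lra.
have er : e + 4 * r <= 1 / 64 by lra.
have er2 : 2 * e + 8 * r ^+ 2 <= (1 / 64) ^+ 2.
  by rewrite r64 /e !expr2; have := mulr_ge0 (ltW r0) (ltW r0); lra.
have [p p0 ep] := int_expw_small (measurable_majorant mf)
  (fun x _ => majorant_ge0 f x) intf e0.
have [u Du fu] : exists2 u, picard_dom p r u &
    forall x, I x -> picard h H f u x = u x.
  apply: (picard_fixpoint p0 (ltW l0) (ltW e0) (ltW r0) mf ep el _ Ce).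
  - by rewrite /e; lra.
  - by rewrite -/C -Kl; lra.
  - by lra.
  - exact: er.
  - exact: er2.
have mN := Cmeas_quot mf Du.1.
have sN : small p (1 / 64) (quot f u).
  exact: (small_quot p0 (ltW e0) (ltW r0) mf ep er er2 Du).
exists (quot f u), p; split=> //.
apply: ae_all => x xI.
have l1 : (0 : R) <= 1 / 64 by lra.
apply/(main_term_cvgP h H p0 l1 mN sN _ _ xI); first by lra.
by rewrite pi_quot// -{1}(fu x xI) /picard subrK.
Qed.

(** The contraction needs one common [p] for both solutions; it is obtained from the sum of their
    majorants. *)
Lemma main_equation_unique_L2 (h H : R[i]) (f N N' : R -> R[i]) :
  L2 `]0, pi[ (fun x => (pi - x)%:C * N x) -> main_equation h H f N ->
  L2 `]0, pi[ (fun x => (pi - x)%:C * N' x) -> main_equation h H f N' ->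
  {ae mu, forall x, I x -> N' x = N x}.
Proof.
move=> /L2_majorant[mM iM] eN /L2_majorant[mM' iM'] eN'.
(* The L2 hypotheses give measurability of (pi - x) K only. *)
have Cmeas_div (K : R -> R[i]) : Cmeas I (fun x => (pi - x)%:C * K x) -> Cmeas I K.
  move=> mK; apply: Cmeas_eq (CmeasM Cmeas_pi_inv mK) => x /set_mem/mem_itv0 xI.
  rewrite mulrA -rmorphM/= mulVf ?mul1r//.
  by apply: lt0r_neq0; lra.
set M := fun x => _ * N x in mM iM; set M' := fun x => _ * N' x in mM' iM'.
have C0 := Psi_bound_ge0 h H; set C := Psi_bound h H in C0.
(* (1 + C) e = 2^(-16) controls [e] and C e at once, for 2 e <= (1/64)^2 and C e <= 1/16. *)
pose e : R := 1 / 256 * (1 / 256) / (1 + C).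
have C1 : 0 < 1 + C by lra.
have e0 : 0 < e by apply: divr_gt0; [lra|exact: C1].
have eC : (1 + C) * e = 1 / 256 * (1 / 256).
  by rewrite /e mulrC divfK//; exact: lt0r_neq0.
have Ce0 : 0 <= C * e by rewrite mulr_ge0// ltW.
have mm : measurable_fun I (fun x => majorant M x + majorant M' x).
  by apply: measurable_funD; exact: measurable_majorant.
have ig : (\int[mu]_(t in I) (majorant M t + majorant M' t)%:E < +oo)%E.
  under eq_integral do rewrite EFinD.
  rewrite ge0_integralD//.
  - exact: lte_add_pinfty.
  - by move=> t _; rewrite lee_fin majorant_ge0.
  - by apply/measurable_EFinP; exact: measurable_majorant.
  - by move=> t _; rewrite lee_fin majorant_ge0.
  - by apply/measurable_EFinP; exact: measurable_majorant.
have [p p0 ep] := int_expw_small mm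
  (fun x _ => addr_ge0 (majorant_ge0 M x) (majorant_ge0 M' x)) ig e0.
have smallK (K : R -> R[i]) : Cmeas I (fun x => (pi - x)%:C * K x) ->
    (forall x, majorant (fun x => (pi - x)%:C * K x) x <=
      majorant M x + majorant M' x) ->
    (\int[mu]_(t in I) (majorant (fun x => ((pi - x)%:C * K x)%R) t * expw p t)%:E
      <= e%:E)%E /\ small p (1 / 64) K.
  move=> mK Kle.
  have h1 : (\int[mu]_(t in I)
      (majorant (fun x => ((pi - x)%:C * K x)%R) t * expw p t)%:E <= e%:E)%E.
    apply: le_trans ep; apply: ge0_le_integral => //.
    - by move=> t _; rewrite lee_fin mulr_ge0 ?majorant_ge0 ?expR_ge0.
    - apply/measurable_EFinP; apply: measurable_funM; last exact: measurable_expw.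
      exact: measurable_majorant.
    - apply/measurable_EFinP; apply: measurable_funM; last exact: measurable_expw.
      exact: mm.
    - by move=> t _; rewrite lee_fin ler_wpM2r ?expR_ge0.
  split=> //.
  apply: (small_majorant p0 (ltW e0) (lexx 0) mK (Cmeas_div _ mK) h1).
  - by move=> t _; rewrite subrr norm10 mulr0.
  - by move: eC; rewrite mulrDl mul1r; lra.
  - by move: eC; rewrite mulrDl mul1r expr0n /= mulr0 expr2; lra.
have leM x : majorant M x <= majorant M x + majorant M' x.
  by rewrite lerDl majorant_ge0.
have leM' x : majorant M' x <= majorant M x + majorant M' x.
  by rewrite lerDr majorant_ge0.
have [eM sN] := smallK N mM leM; have [_ sN'] := smallK N' mM' leM'.
have l1 : (0 : R) <= 1 / 64 by lra.
apply: (main_equation_unique p0 l1 (lexx _) (ltW e0) (Cmeas_div _ mM) sN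
  (Cmeas_div _ mM') sN' (int_expw_le_majorant mM eM) _ eN eN').
by move: eC; rewrite mulrDl mul1r; move: e0; rewrite -/C; lra.
Qed.

End theory.

Theorem theorem4 (R : realType) (f : R -> R[i]) (h H : R[i])
    (hf : L2 `]0, pi[ f) :
  exists N : R -> R[i],
    [/\ L2 `]0, pi[ (fun x => (pi - x)%:C * N x),
        main_equation h H f N &
        forall N' : R -> R[i],
          L2 `]0, pi[ (fun x => (pi - x)%:C * N' x) ->
          main_equation h H f N' ->
          {ae lebesgue_measure, forall x : R, `]0, pi[%classic x -> N' x = N x}].
Proof.
have [N [p [p0 mN sN eN]]] := main_equation_exists h H hf.
have LN := small_L2 p0 mN sN.
by exists N; split=> // N' LN' eN'; exact: main_equation_unique_L2 eN LN' eN'.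
Qed.
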